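(* Let $\Delta$ and $\Gamma$ be clique complexes of chordal graphs on $N$ and $N'$ vertices, respectively, and assume that each has at least two facets. Choose leaf orders, with multisets of facet and separator sizes $\{n_1,\ldots,n_e\}$, $\{r_1,\ldots,r_{e-1}\}$ for $\Delta$, and $\{n'_1,\ldots,n'_{e'}\}$, $\{r'_1,\ldots,r'_{e'-1}\}$ for $\Gamma$. Put $\delta=N'-N$. Then the following conditions are equivalent. (i) The rings $\mathbb K[\Delta^\vee]$ and $\mathbb K[\Gamma^\vee]$ have the same graded Betti table. (ii) The multisets of facet and separator cardinalities differ by the common shift $\delta$: as multisets, $$\{n'_1,\ldots,n'_{e'}\}=\{n_1+\delta,\ldots,n_e+\delta\},\qquad\{r'_1,\ldots,r'_{e'-1}\}=\{r_1+\delta,\ldots,r_{e-1}+\delta\}.$$ In particular, if $N=N'$, the graded Betti table determines both multisets exactly. In that case (i.e. $N=N'$ and (i), (ii) hold), $\mathbb K[\Delta_{(k)}]$ and $\mathbb K[\Gamma_{(k)}]$ have the same graded Betti table for every $k$, and the same is true of $\mathbb K[(\Delta^\vee)_{(k)}]$ and $\mathbb K[(\Gamma^\vee)_{(k)}]$ whenever the corresponding skeletons are defined.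
   Context: $\mathbb K$ is a field. For a finite set $X$, put $R=\mathbb K[x:x\in X]$ with the standard grading. A simplicial complex $\Sigma$ on $X$ is a collection of subsets (faces) of $X$ closed under inclusion; elements of $X$ not lying in any face (ghost vertices) are allowed. A face $F$ has dimension $|F|-1$. The $k$-skeleton $\Sigma_{(k)}$ ($k\ge-1$) consists of all faces of dimension at most $k$, viewed as a complex on the same set $X$; $\Sigma_{(-1)}=\{\varnothing\}$. The Alexander dual on $X$ is $\Sigma^\vee=\{F\subseteq X:X\setminus F\notin\Sigma\}$. $I_\Sigma\subseteq R$ is generated by the monomials $\prod_{x\in A}x$ with $A\subseteq X$, $A\notin\Sigma$; $\mathbb K[\Sigma]=R/I_\Sigma$. The graded Betti table of $\mathbb K[\Sigma]$ is the collection of graded Betti numbers $\beta_{i,j}$ of $\mathbb K[\Sigma]$ over its own polynomial ring $R$ (with as many variables as $|X|$); for $\Delta$ and $\Gamma$ (and their duals and skeletons) the set $X$ is the vertex set of the respective graph. The clique complex of a finite graph consists of its cliques; its facets are the maximal cliques. A leaf order of the facets is an ordering $S_1,\ldots,S_e$ such that for each $m\ge2$ there is $p(m)<m$ satisfying $S_m\cap S_i\subseteq S_m\cap S_{p(m)}$ for all $i<m$; such an order exists when the graph is chordal. Facet sizes are $n_m=|S_m|$; for $1\le m\le e-1$ the separators are $Q_m=(S_1\cup\cdots\cup S_m)\cap S_{m+1}=S_{p(m+1)}\cap S_{m+1}$ (possibly empty), with sizes $r_m=|Q_m|$. *)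

(* Defs.v *)
From mathcomp Require Import all_boot all_order all_algebra.
From mathcomp Require Import mpoly.

Set Implicit Arguments.
Unset Strict Implicit.
Unset Printing Implicit Defensive.

Import Order.TTheory GRing.Theory Num.Theory.

Local Open Scope ring_scope.

(* A simplicial complex on X is its set of faces, of type {set {set X}};
   elements of X lying in no face are ghost vertices. *)

Section Complexes.
Variable X : finType.
Implicit Types S : {set {set X}}.

Definition alexander_dual S : {set {set X}} := [set F | ~: F \notin S].

(* #|F| - 1 is the dimension of F; the subtraction is in int, so that the
   empty face has dimension -1. *)
Definition skeleton (k : int) S : {set {set X}} :=
  [set F in S | #|F|%:Z - 1 <= k].

Definition facets S : {set {set X}} := [set F | maxset (fun A => A \in S) F].

(* The facets are numbered from 0, hence 0 < m rather than 2 <= m. *)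
Definition leaf_order S (s : seq {set X}) : Prop :=
  perm_eq s (enum (facets S)) /\
  forall m, (0 < m < size s)%N ->
    exists2 p, (p < m)%N & forall i, (i < m)%N ->
      nth set0 s m :&: nth set0 s i \subset nth set0 s m :&: nth set0 s p.

Definition facet_sizes (s : seq {set X}) : seq nat := [seq #|A| | A : {set X} <- s].

Definition separators (s : seq {set X}) : seq {set X} :=
  [seq (\bigcup_(A <- take m s) A) :&: nth set0 s m | m <- iota 1 (size s).-1].

Definition separator_sizes (s : seq {set X}) : seq nat :=
  [seq #|A| | A : {set X} <- separators s].

End Complexes.

Section Graphs.
Variables (V : finType) (e : rel V).

Definition clique (F : {set V}) : bool :=
  [forall x in F, forall y in F, (x != y) ==> e x y].

Definition clique_complex : {set {set V}} := [set F | clique F].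

Definition chordal : Prop :=
  forall c : seq V, ucycle e c -> (4 <= size c)%N ->
  exists x y, [/\ x \in c, y \in c, e x y, y != next c x & x != next c y].

End Graphs.

Section StanleyReisner.
Variables (K : fieldType) (X : finType).

(* The variable attached to x : X is 'X_(enum_rank x). *)
Local Notation R := {mpoly K[#|X|]}.

Definition face_monomial (A : {set X}) : R := \prod_(x in A) 'X_(enum_rank x).

Definition in_SR_ideal (S : {set {set X}}) (f : R) : Prop :=
  exists c : {set X} -> R, f = \sum_(A | A \notin S) c A * face_monomial A.

(* F_i is the free R-module of row vectors of length rk i, its a-th basis
   element having degree deg a; matrices act on the right, so that
   dif i : F_(i+1) -> F_i is v |-> v *m dif i. The map F_0 -> K[S] sends v to
   the class of (v *m aug) 0 0. Basis degrees are natural numbers: since K[S]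
   lives in degrees >= 0, a minimal resolution has no others. *)
Record free_complex := FreeComplex {
  rk : nat -> nat;
  deg : forall i, 'I_(rk i) -> nat;
  aug : 'cV[R]_(rk 0);
  dif : forall i, 'M[R]_(rk i.+1, rk i)
}.

(* p is zero or homogeneous of degree d' - d; in particular p = 0 if d' < d. *)
Definition homog_entry (d' d : nat) (p : R) : Prop :=
  forall m, m \in msupp p -> (mdeg m + d)%N = d'.

Definition graded (F : free_complex) : Prop :=
  (forall a, homog_entry (deg a) 0 (aug F a 0)) /\
  (forall i (b : 'I_(rk F i.+1)) (a : 'I_(rk F i)),
     homog_entry (deg b) (deg a) (dif F i b a)).

Definition resolves (S : {set {set X}}) (F : free_complex) : Prop :=
  [/\ forall f : R, exists v : 'rV[R]_(rk F 0),
        in_SR_ideal S (f - (v *m aug F) 0 0),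
      forall v : 'rV[R]_(rk F 0),
        in_SR_ideal S ((v *m aug F) 0 0) <-> exists w, v = w *m dif F 0
    & forall i (v : 'rV[R]_(rk F i.+1)),
        v *m dif F i = 0 <-> exists w, v = w *m dif F i.+1].

(* The differentials have entries in the ideal generated by the variables. *)
Definition minimal (F : free_complex) : Prop :=
  forall i (b : 'I_(rk F i.+1)) (a : 'I_(rk F i)), (dif F i b a)@_0%MM = 0.

Definition minimal_free_resolution (S : {set {set X}}) (F : free_complex) :=
  [/\ graded F, resolves S F & minimal F].

Definition betti_number (F : free_complex) (i j : nat) : nat :=
  #|[set a : 'I_(rk F i) | deg a == j]|.

(* beta is the graded Betti table of K[S] over R. *)
Definition betti_table (S : {set {set X}}) (beta : nat -> nat -> nat) : Prop :=
  exists2 F, minimal_free_resolution S F &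
    forall i j, beta i j = betti_number F i j.

End StanleyReisner.

Definition same_betti (K : fieldType) (X Y : finType)
    (S : {set {set X}}) (T : {set {set Y}}) : Prop :=
  exists2 beta, betti_table K S beta & betti_table K T beta.

(* Main.v *)
Require Import Defs.
From mathcomp Require Import mpoly.
From mathcomp Require Import all_boot all_order all_algebra.
Import Order.TTheory GRing.Theory Num.Theory.
Local Open Scope ring_scope.

Set Implicit Arguments.
Unset Strict Implicit.
Unset Printing Implicit Defensive.

(** Everything rests on Hochster's formula, in a form that needs neither homology of
    simplicial complexes nor Tor. A minimal free resolution of a Stanley-Reisner
    ring can be written with monomial matrices, so that it is given by scalar
    matrices and by labels, which are subsets of [X]; its exactness is a condition
    on finite-dimensional vector spaces, one for each subset [U]
    ([squarefree_resolution], [realize_resolution]). Such data exist for every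
    complex containing the empty set: add, degree by degree, a basis of the syzygies
    not generated in smaller degrees ([minimal_squarefreeP]). Koszul cohomology of the
    syzygies and dimension shifting show that the number of basis elements of degree
    [U] is the dimension of a cohomology space of the ideal on the subsets of [U]
    ([hochster]). On the other hand graded Betti numbers do not depend on the
    minimal resolution ([betti_number_unique]), by comparison maps and homotopies,
    so that any squarefree resolution computes them ([same_bettiP]).

    The equivalence comes from an explicit resolution of the ring of the Alexander
    dual, of length two. Its ideal is generated by the complements of the facets. A
    leaf order makes the facets the vertices of a tree, with an edge from each facet
    to its parent, and the facets containing a given face form a subtree; hence the
    edges, whose degrees are the complements of the separators, form a basis of the
    syzygies ([dual_resolution]). So [beta_1] is the multiset of the [N - n_m] and
    [beta_2] that of the [N - r_m], and complements turn equality of the tables into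
    the common shift [N' - N].

    For the skeletons, the alternating sums over [i] of the Betti numbers of degree
    [j] carry the same information as the face numbers. Hence all strands [j - i = d]
    but one, together with the face numbers, determine the last one
    ([sbetti_off_strand]). In the skeleton with faces of at most [d] elements,
    Hochster's formula shows that the strands below [d] are those of the complex and
    that the strands above [d] vanish; so the Betti table of the skeleton is
    determined by that of the complex ([sbetti_skel]). For the dual this is all that
    is needed. For the clique complex itself, its cohomology vanishes above degree
    zero on all induced subcomplexes, by Mayer-Vietoris along the leaf order
    ([leaf_acyclic]); its table is concentrated on one strand apart from
    [beta_{0,0}], and is determined by the face numbers, which are complementary to
    those of the dual ([linear_betti_eq], [face_number_dual]). *)

(** * Cochains on the subsets of a finite set *)

Definition down_closed (X : finType) (S : {set {set X}}) : Prop :=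
  forall U B : {set X}, U \in S -> B \subset U -> B \in S.

Section Cochains.
Variables (K : fieldType) (X : finType).
Implicit Types (B C U : {set X}) (x y : X).

Definition before x C : nat := #|[set y in C | (enum_rank y < enum_rank x)%N]|.

(** [sgn x C] is the incidence sign of [C] in [x |: C], vertices being ordered by
    [enum_rank]. *)
Definition sgn x C : K := (-1) ^+ before x C.

Lemma sgn_sq x C : sgn x C * sgn x C = 1.
Proof. by rewrite -expr2 sqrr_sign. Qed.

Lemma before_setU1 x y C : x \notin C ->
  before y (x |: C) = ((enum_rank x < enum_rank y) + before y C)%N.
Proof.
move=> xC; rewrite /before (cardsD1 x) !inE eqxx /=; congr (_ + #|pred_of_set _|)%N.
apply/setP=> z; rewrite !inE; case: (z =P x) => // ->.
by rewrite (negbTE xC).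
Qed.

(** Exactly one of the two vertices precedes the other, so that exactly one of
    the two parities changes: this sign makes the coboundary square to zero. *)
Lemma sgn_swap x y C : x != y -> x \notin C -> y \notin C ->
  sgn x (y |: C) * sgn y C = - (sgn y (x |: C) * sgn x C).
Proof.
move=> xy xC yC; rewrite /sgn !before_setU1 // !exprD.
have : (enum_rank x != enum_rank y :> nat) by rewrite (inj_eq val_inj) (inj_eq enum_rank_inj).
by case: ltngtP => //= _ _; rewrite expr0 expr1 !(mul1r, mulN1r) ?mulNr ?opprK mulrC.
Qed.

(** The simplicial coboundary. Read on complements in a fixed set [U], it is the
    differential of the Koszul complex in squarefree degree [U]. *)
Definition cobd (V : lmodType K) (z : {set X} -> V) B : V :=
  \sum_(x in B) sgn x (B :\ x) *: z (B :\ x).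

Lemma eq_cobd (V : lmodType K) (z z' : {set X} -> V) B :
  (forall x, x \in B -> z (B :\ x) = z' (B :\ x)) -> cobd z B = cobd z' B.
Proof. by move=> zz; apply: eq_bigr => x xB; rewrite zz. Qed.

Lemma cobdD (V : lmodType K) (z z' : {set X} -> V) B :
  cobd (fun C => z C + z' C) B = cobd z B + cobd z' B.
Proof. by rewrite -big_split; apply: eq_bigr => x _; rewrite scalerDr. Qed.

Lemma cobdN (V : lmodType K) (z : {set X} -> V) B :
  cobd (fun C => - z C) B = - cobd z B.
Proof. by rewrite -sumrN; apply: eq_bigr => x _; rewrite scalerN. Qed.

Lemma cobd_sum (V : lmodType K) (J : finType) (c : J -> K) (z : J -> {set X} -> V) B :
  cobd (fun C => \sum_j c j *: z j C) B = \sum_j c j *: cobd (z j) B.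
Proof.
rewrite (eq_bigr (fun j => \sum_(x in B) c j *: (sgn x (B :\ x) *: z j (B :\ x))));
  last by move=> j _; rewrite scaler_sumr.
rewrite exchange_big; apply: eq_bigr => x _; rewrite scaler_sumr.
by apply: eq_bigr => j _; rewrite !scalerA mulrC.
Qed.

(** The terms for [(x, y)] and [(y, x)] are opposite. They are paired along the
    vertex order, because antisymmetry alone says nothing in characteristic 2. *)
Lemma cobd_cobd (V : lmodType K) (z : {set X} -> V) B : cobd (cobd z) B = 0.
Proof.
pose t x y := (sgn x (B :\ x) * sgn y (B :\ x :\ y)) *: z (B :\ x :\ y).
have -> : cobd (cobd z) B = \sum_(x in B) \sum_(y in B | y != x) t x y.
  apply: eq_bigr => x xB; rewrite scaler_sumr; apply: eq_big => [y|y _].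
    by rewrite !inE andbC.
  by rewrite scalerA.
have setD1C x y : B :\ x :\ y = B :\ y :\ x.
  by apply/setP=> w; rewrite !inE andbCA.
have tC x y : x \in B -> y \in B -> y != x -> t x y = - t y x.
  move=> xB yB yx.
  have xy : x != y by rewrite eq_sym.
  have -> : t y x = (sgn y (B :\ y) * sgn x (B :\ x :\ y)) *: z (B :\ x :\ y).
    by rewrite /t setD1C.
  rewrite /t -scaleNr; congr (_ *: _); set C := B :\ x :\ y.
  have -> : B :\ x = y |: C by rewrite setD1K // !inE yx.
  have -> : B :\ y = x |: C by rewrite /C setD1C setD1K // !inE xy.
  by rewrite sgn_swap // !inE eqxx ?andbF.
pose lt x y := (enum_rank x < enum_rank y)%N.
rewrite (eq_bigr (fun x => \sum_(y in B | lt x y) t x y + \sum_(y in B | lt y x) t x y));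
  last first.
  move=> x xB; rewrite (bigID (lt x)) /=; congr (_ + _); apply: eq_bigl => y;
  rewrite /lt -andbA; congr (_ && _).
    by case: (y =P x) => //= ->; rewrite ltnn.
  by rewrite -leqNgt ltn_neqAle (inj_eq val_inj) (inj_eq enum_rank_inj).
rewrite big_split /=.
have -> : \sum_(x in B) \sum_(y in B | lt y x) t x y
        = \sum_(x in B) \sum_(y in B | lt x y) t y x.
  rewrite (exchange_big_dep (mem B)) => [|x y _ /andP[] //].
  by apply: eq_bigr => x xB; apply: eq_bigl => y; rewrite [x \in B]xB.
rewrite -big_split big1 // => x xB; rewrite -big_split big1 //= => y /andP[yB xy].
rewrite (tC x y) ?addNr //; by apply: contraTN xy => /eqP->; rewrite /lt ltnn.
Qed.

Section Contraction.
Variables (V : lmodType K) (U : {set X}) (x0 : X) (q : nat) (f : {set X} -> V).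

(** The contracting homotopy towards the vertex [x0]. *)
Definition cone C : V := if x0 \in C then 0 else sgn x0 C *: f (x0 |: C).

(** If [x0] lies in [B], only the term [x0] of the coboundary survives. If not,
    the cocycle condition on [x0 |: B] expresses [f B] through the values of [f]
    on the sets containing [x0]. *)
Lemma cobd_cone B : x0 \in U -> B \subset U -> #|B| = q ->
  (forall C, C \subset U -> #|C| = q.+1 -> cobd f C = 0) ->
  f B = cobd cone B.
Proof.
move=> x0U BU cB cocyc; have [x0B|x0B] := boolP (x0 \in B).
  rewrite /cobd (bigD1 x0) //= big1 => [|x /andP[xB xx0]]; last first.
    by rewrite /cone !inE eq_sym xx0 x0B scaler0.
  by rewrite addr0 /cone setD11 setD1K // scalerA sgn_sq scale1r.
have := cocyc (x0 |: B); rewrite subUset sub1set x0U BU cardsU1 x0B cB => /(_ isT erefl).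
rewrite /cobd big_setU1 //= setU1K // => /eqP; rewrite addr_eq0 => /eqP fB.
have -> : f B = sgn x0 B *: (sgn x0 B *: f B) by rewrite scalerA sgn_sq scale1r.
rewrite fB scalerN -scaleNr scaler_sumr; apply: eq_bigr => x xB.
have x0x : x0 != x by apply: contraNneq x0B => ->.
have -> : (x0 |: B) :\ x = x0 |: (B :\ x).
  by apply/setP=> y; rewrite !inE; case: (y =P x0) => [->|]; rewrite ?x0x.
set C := B :\ x; have x0C : x0 \notin C by rewrite !inE (negbTE x0B) andbF.
have xC : x \notin C by rewrite !inE eqxx.
have BE : x |: C = B by rewrite setD1K.
rewrite /cone (negbTE x0C) !scalerA; congr (_ *: _).
have := sgn_swap x0x x0C xC; rewrite BE => sw.
have -> : sgn x (x0 |: C) = - (sgn x0 B * sgn x C * sgn x0 C).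
  by rewrite sw mulNr opprK -mulrA sgn_sq mulr1.
by rewrite mulrNN !mulrA sgn_sq mul1r.
Qed.

End Contraction.

Section Cohomology.
Variable V : lmodType K.
Implicit Types (Z : {set X} -> V -> Prop) (z : {set X} -> V).

(** The coefficients [Z] are a family of subspaces of [V] indexed by the subsets;
    a cochain of size [q] on [U] is only looked at on the subsets of [U] with [q]
    elements. *)
Definition cochain Z U q z := forall B, B \subset U -> #|B| = q -> Z B (z B).

Definition cocycle Z U q z :=
  cochain Z U q z /\ forall B, B \subset U -> #|B| = q.+1 -> cobd z B = 0.

Definition coboundary Z U q z := exists2 w : {set X} -> V,
  forall B, B \subset U -> #|B|.+1 = q -> Z B (w B) &
  forall B, B \subset U -> #|B| = q -> z B = cobd w B.

(** The dimension of a cohomology space is recorded by a basis indexed by a finite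
    type instead of a quotient space: connecting maps then act on representatives. *)
Definition cohom_basis Z U q (J : finType) := exists zs : J -> {set X} -> V,
  [/\ forall j, cocycle Z U q (zs j),
      forall z, cocycle Z U q z -> exists c : J -> K,
        coboundary Z U q (fun B => z B - \sum_j c j *: zs j B)
    & forall c : J -> K, coboundary Z U q (fun B => \sum_j c j *: zs j B) ->
        forall j, c j = 0].

Definition submod Z := [/\ forall B, Z B 0,
  forall B u v, Z B u -> Z B v -> Z B (u + v) &
  forall B a u, Z B u -> Z B (a *: u)].

Lemma submod_sum Z (I : Type) (r : seq I) (P : pred I) (F : I -> V) B : submod Z ->
  (forall i, P i -> Z B (F i)) -> Z B (\sum_(i <- r | P i) F i).
Proof. by case=> Z0 ZD _ ZF; apply: big_ind => // u v; apply: ZD. Qed.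

Lemma submodN Z B u : submod Z -> Z B u -> Z B (- u).
Proof. by case=> _ _ ZZ Zu; rewrite -scaleN1r; apply: ZZ. Qed.

Lemma coboundaryD Z U q z z' : submod Z -> coboundary Z U q z -> coboundary Z U q z' ->
  coboundary Z U q (fun B => z B + z' B).
Proof.
case=> _ ZD _ [y Zy zy] [y' Zy' zy']; exists (fun B => y B + y' B) => B BU cB.
  by apply: ZD; [apply: Zy|apply: Zy'].
by rewrite cobdD -zy -?zy'.
Qed.

Lemma coboundary_sum Z U q (J : finType) (c : J -> K) zs : submod Z ->
  (forall j, coboundary Z U q (zs j)) ->
  coboundary Z U q (fun B => \sum_j c j *: zs j B).
Proof.
move=> Zs /fin_all_exists2[ys Zy zy]; exists (fun B => \sum_j c j *: ys j B) => B BU cB.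
  by apply: submod_sum => // j _; case: (Zs) => _ _ ZZ; apply/ZZ/Zy.
by rewrite cobd_sum; apply: eq_bigr => j _; rewrite -zy.
Qed.

Lemma eq_coboundary Z U q z z' :
  (forall B, B \subset U -> #|B| = q -> z B = z' B) ->
  coboundary Z U q z -> coboundary Z U q z'.
Proof. by move=> zz [y Zy zy]; exists y => // B BU cB; rewrite -zz // zy. Qed.

(** Expressing each basis in the other gives two matrices whose product is the
    identity. *)
Lemma cohom_basis_le Z U q (J J' : finType) : submod Z ->
  cohom_basis Z U q J -> cohom_basis Z U q J' -> (#|J| <= #|J'|)%N.
Proof.
move=> Zs [zs [zs_cyc zs_gen zs_free]] [zs' [zs'_cyc zs'_gen _]].
have [A zsA] := fin_all_exists (fun j => zs'_gen _ (zs_cyc j)).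
have [A' zsA'] := fin_all_exists (fun k => zs_gen _ (zs'_cyc k)).
pose a i j := \sum_k A i k * A' k j.
have aE i j : a i j = (i == j)%:R.
  suff: (i == j)%:R - a i j = 0 by move/eqP; rewrite subr_eq0 => /eqP.
  move: j; apply: (zs_free (fun j => (i == j)%:R - a i j)).
  have Hs := coboundary_sum (A i) Zs zsA'.
  apply: eq_coboundary (coboundaryD Zs (zsA i) Hs) => B _ _.
  under [X in _ + X = _]eq_bigr => k _ do rewrite scalerBr scaler_sumr.
  rewrite sumrB addrA subrK.
  under [in RHS]eq_bigr do rewrite scalerBl.
  rewrite sumrB (bigD1 i) //= eqxx scale1r.
  rewrite [X in _ = _ + X - _]big1 => [|j ji]; last by rewrite eq_sym (negbTE ji) scale0r.
  rewrite addr0 exchange_big /=; congr (_ - _); apply: eq_bigr => j _.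
  by rewrite scaler_suml; apply: eq_bigr => k _; rewrite scalerA.
pose mA := \matrix_(i < #|J|, k < #|J'|) A (enum_val i) (enum_val k).
pose mA' := \matrix_(k < #|J'|, i < #|J|) A' (enum_val k) (enum_val i).
apply: (@mulmx1_min _ _ _ mA mA'); apply/matrixP=> i j; rewrite !mxE.
under eq_bigr do rewrite !mxE.
rewrite -(inj_eq enum_val_inj) -aE /a.
by rewrite -(big_enum_val (fun k => A (enum_val i) k * A' k (enum_val j))).
Qed.

End Cohomology.
End Cochains.

(** * Squarefree complexes and their cohomology *)

Section Squarefree.
Variables (K : fieldType) (X : finType).
Implicit Types (S : {set {set X}}) (B C U : {set X}).

(** The scalar data of a complex of free R-modules graded by the subsets of
    [X]: [lab a] is the squarefree degree of the basis element [a], and the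
    differential sends the basis element [b] to the sum over [a] of
    [smx b a] times the monomial of [lab b :\: lab a] times [a]. *)
Record squarefree_complex := SquarefreeComplex {
  srk : nat -> nat;
  lab : forall i, 'I_(srk i) -> {set X};
  smx : forall i, 'M[K]_(srk i.+1, srk i)
}.

(** The component of squarefree degree [U] of a free module has one dimension for
    each basis element whose label lies in [U]; here it is embedded in the space
    of all coefficient vectors. *)
Definition in_strand r (W : 'I_r -> {set X}) U (v : 'rV[K]_r) :=
  forall a, v 0 a != 0 -> W a \subset U.

(** The degree [U] component of the [i]-th syzygy module; for [i = 0] this is the
    Stanley-Reisner ideal, which is everything when [U] is not a face. *)
Definition syzygies S (D : squarefree_complex) i U : 'rV[K]_(srk D i) -> Prop :=
  match i return 'rV[K]_(srk D i) -> Prop with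
  | 0 => fun v => U \in S -> v = 0
  | j.+1 => fun v => in_strand (@lab D j.+1) U v /\ v *m smx D j = 0
  end.

(** Exactness is a condition on finite-dimensional spaces, one for each [U]: the
    component of a multidegree only depends on its support. The last clause is
    minimality. *)
Definition squarefree_resolution S D :=
  [/\ srk D 0 = 1%N, forall a : 'I_(srk D 0), lab a = set0,
      forall i U (v : 'rV_(srk D i)), syzygies S U v <->
        exists2 w, in_strand (@lab D i.+1) U w & v = w *m smx D i
    & forall i (b : 'I_(srk D i.+1)) (a : 'I_(srk D i)),
        smx D i b a != 0 -> lab a != lab b].

Lemma in_strand_submod r (W : 'I_r -> {set X}) : submod (in_strand W).
Proof.
split=> [B a|B u v su sv a|B c u su a]; rewrite !mxE ?eqxx //; last first.
  by rewrite mulf_eq0 negb_or => /andP[_ /su].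
by case: (u 0 a =P 0) => [->|/eqP/su//]; rewrite add0r => /sv.
Qed.

Lemma in_strand_sum r (W : 'I_r -> {set X}) U (I : finType) (P : pred I) (F : I -> 'rV_r) :
  (forall i, P i -> in_strand W U (F i)) -> in_strand W U (\sum_(i | P i) F i).
Proof. by move=> sF; exact (@submod_sum _ _ _ (in_strand W) _ _ P F U (in_strand_submod W) sF). Qed.

Lemma in_strandB r (W : 'I_r -> {set X}) U (u v : 'rV_r) :
  in_strand W U u -> in_strand W U v -> in_strand W U (u - v).
Proof.
have [_ sD _] := in_strand_submod W => su sv; apply: sD => //.
exact (@submodN _ _ _ (in_strand W) U v (in_strand_submod W) sv).
Qed.

Lemma syzygies_submod S D i : submod (fun U => @syzygies S D i U).
Proof.
case: i => [|i]; first by split=> [||B c u Zu] //=; [move=> B u v Zu Zv|] => BS;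
  rewrite ?Zu ?Zv ?addr0 ?scaler0.
have [s0 sD sZ] := in_strand_submod (@lab D i.+1).
split=> [B|B u v [su u0] [sv v0]|B c u [su u0]]; first by rewrite /= mul0mx.
  by split; [apply: sD|rewrite mulmxDl u0 v0 addr0].
by split; [apply: sZ|rewrite -scalemxAl u0 scaler0].
Qed.

Lemma cobd_coord r (z : {set X} -> 'rV[K]_r) B a :
  cobd z B 0 a = cobd (fun C => z C 0 a : K^o) B.
Proof. by rewrite summxE; apply: eq_bigr => x _; rewrite mxE. Qed.

(** A free module has no Koszul homology in positive degree. Each coordinate [a]
    is contracted towards a vertex of [U] outside [W a]; the only obstruction is
    [W a = U], which the second hypothesis excludes. *)
Lemma in_strand_acyclic r (W : 'I_r -> {set X}) U q z :
  cocycle (in_strand W) U q z ->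
  (forall B a, B \subset U -> #|B| = q -> z B 0 a != 0 -> W a != U) ->
  coboundary (in_strand W) U q z.
Proof.
move=> [zW z_cyc] zU.
pose px a := [pick x in U :\: W a].
exists (fun B => \row_a if px a is Some x then cone x (fun C => z C 0 a : K^o) B else 0).
  move=> B BU cB a; rewrite mxE /px; case: pickP => [x|]; last by rewrite eqxx.
  rewrite inE => /andP[xW xU]; rewrite /cone; case: ifP => [|/negbT xB]; first by rewrite eqxx.
  rewrite mulf_eq0 negb_or => /andP[_ /zW]; rewrite subUset sub1set xU BU cardsU1 xB add1n cB.
  move=> /(_ isT erefl) /subsetP sW; apply/subsetP=> y yW.
  by have := sW y yW; rewrite !inE => /predU1P[yx|//]; rewrite -yx yW in xW.
move=> B BU cB; apply/rowP=> a; rewrite cobd_coord.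
transitivity (cobd (fun C =>
    (if px a is Some x then cone x (fun C => z C 0 a : K^o) C else 0) : K^o) B);
  last by apply: eq_bigr => x _; rewrite mxE.
rewrite /px; case: pickP => [x|Wa].
  rewrite inE => /andP[xW xU]; apply: (cobd_cone (f := fun C => z C 0 a : K^o) xU BU cB) => C CU cC.
  by rewrite -cobd_coord z_cyc ?mxE.
rewrite /cobd big1 => [|x _]; last by rewrite scaler0.
apply/eqP/negPn/negP => za; have /negP := zU B a BU cB za.
rewrite eqEsubset (subset_trans (zW _ BU cB _ za) BU) /=; case.
by apply/subsetP=> x xU; have := Wa x; rewrite !inE xU andbT => /negbFE.
Qed.

Lemma big_sig_val (V : nmodType) (T : finType) (P : pred T) (F : T -> V) :
  \sum_(j : {x | P x}) F (val j) = \sum_(x | P x) F x.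
Proof.
rewrite [RHS](reindex_omap (val : {x | P x} -> T) insub) => [|x Px]; last by rewrite insubT.
by apply: eq_bigl => j; rewrite valK eqxx andbT (valP j).
Qed.

Lemma cobd_in_strand r (W : 'I_r -> {set X}) U (u : {set X} -> 'rV_r) B :
  (forall C, C \subset U -> #|C|.+1 = #|B| -> in_strand W C (u C)) ->
  B \subset U -> in_strand W B (cobd u B).
Proof.
move=> uW BU; apply: in_strand_sum => x xB a.
rewrite mxE mulf_eq0 negb_or => /andP[_ /uW sW]; apply: subset_trans (subsetDl B [set x]).
by apply: sW; rewrite ?(subset_trans (subsetDl _ _)) // (cardsD1 x B) xB.
Qed.

Lemma in_strand_delta r (W : 'I_r -> {set X}) b : in_strand W (W b) (delta_mx 0 b).
Proof. by move=> a; rewrite mxE eqxx /=; case: (a =P b) => [->|]; rewrite ?eqxx. Qed.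
Arguments in_strand_delta {r} W b _.

Section Hochster.
Variables (S : {set {set X}}) (D : squarefree_complex).
Hypothesis Dres : squarefree_resolution S D.

Lemma syzygies_gen i U w : in_strand (@lab D i.+1) U w -> @syzygies S D i U (w *m smx D i).
Proof. by case: Dres => _ _ ex _ sw; apply/ex; exists w. Qed.

(** Together with the supports imposed by exactness, minimality makes labels grow
    strictly along the differential. *)
Lemma lab_proper i (b : 'I_(srk D i.+1)) (a : 'I_(srk D i)) :
  smx D i b a != 0 -> lab a \proper lab b.
Proof.
case: (Dres) => _ lab0 _ mn Cba; rewrite properEneq mn //=.
have := syzygies_gen (in_strand_delta (@lab D i.+1) b); rewrite -rowE.
case: i b a Cba => [|i] b a Cba; first by rewrite lab0 sub0set.
by case=> /(_ a); rewrite mxE => /(_ Cba).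
Qed.

(** Minimality, seen from the syzygies: no basis element of the same degree occurs
    in a syzygy. *)
Lemma syzygies_proper i U v a : @syzygies S D i U v -> v 0 a != 0 -> lab a \proper U.
Proof.
case: Dres => _ _ ex _ /ex[w sw ->].
have [/eqP|] := boolP [forall b, w 0 b * smx D i b a == 0].
  move=> /eqP/forallP H; rewrite mxE big1 ?eqxx // => b _; exact/eqP.
rewrite negb_forall => /existsP[b]; rewrite mulf_eq0 negb_or => /andP[wb Cb] _.
exact: proper_sub_trans (lab_proper Cb) (sw _ wb).
Qed.

Lemma syzygies_in_strand i U v : @syzygies S D i U v -> in_strand (@lab D i) U v.
Proof. by move=> Zv a va; apply/proper_sub/(syzygies_proper Zv). Qed.

Lemma syzygies_lift i (P : pred {set X}) z : (forall B, P B -> @syzygies S D i B (z B)) ->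
  exists t, forall B, P B -> in_strand (@lab D i.+1) B (t B) /\ z B = t B *m smx D i.
Proof.
move=> Zz; apply: (fin_all_exists (P := fun B tB =>
  P B -> in_strand (@lab D i.+1) B tB /\ z B = tB *m smx D i)) => B.
have [PB|_] := boolP (P B); last by exists 0.
by case: Dres => _ _ ex _; have /ex[w] := Zz B PB; exists w.
Qed.

Lemma cobd_mulmx i (z : {set X} -> 'rV_(srk D i.+1)) B :
  cobd (fun C => z C *m smx D i) B = cobd z B *m smx D i.
Proof. by rewrite mulmx_suml; apply: eq_bigr => x _; rewrite -scalemxAl. Qed.

Lemma coboundary_mulmx i U q z : coboundary (in_strand (@lab D i.+1)) U q z ->
  coboundary (@syzygies S D i) U q (fun B => z B *m smx D i).
Proof.
case=> y sy zy; exists (fun B => y B *m smx D i) => B BU cB; first exact/syzygies_gen/sy.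
by rewrite zy // cobd_mulmx.
Qed.

(** In top size [#|U|] the cohomology of the syzygies is their quotient by what
    comes from smaller degrees, so that it counts the minimal generators of degree
    [U], which are the basis elements labelled [U] of the next module. *)
Lemma generators_basis i U :
  cohom_basis (@syzygies S D i) U #|U| {b : 'I_(srk D i.+1) | lab b == U}.
Proof.
have eqU B : B \subset U -> #|B| = #|U| -> B = U.
  by move=> BU cB; apply/eqP; rewrite eqEcard BU cB leqnn.
have noC (P : {set X} -> Prop) : forall B, B \subset U -> #|B| = #|U|.+1 -> P B.
  by move=> B BU cB; have := subset_leq_card BU; rewrite cB ltnn.
exists (fun j _ => row (val j) (smx D i)); split.
- move=> [b /eqP bU] /=; split=> [B BU cB|]; last exact: noC.
  by rewrite rowE; apply: syzygies_gen; rewrite (eqU B) // -bU; apply: in_strand_delta.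
- move=> z [zZ _]; have := zZ U (subxx _) erefl.
  case: Dres => _ _ ex _ => /ex[w sw zUE].
  (* What is left of [w] outside degree [U] has proper supports. *)
  pose w' := \row_b if lab b == U then 0 else w 0 b.
  exists (fun j => w 0 (val j)).
  have: coboundary (in_strand (@lab D i.+1)) U #|U| (fun=> w').
    apply: in_strand_acyclic.
      split=> [B BU cB a|]; last exact: noC.
      by rewrite mxE (eqU B) //; case: (lab a =P U) => [|_ /sw//]; rewrite eqxx.
    by move=> B a _ _; rewrite mxE; case: (lab a =P U) => [|/eqP//]; rewrite eqxx.
  move/coboundary_mulmx; apply: eq_coboundary => B BU cB.
  rewrite (eqU B) // zUE; apply/rowP=> a; rewrite !mxE summxE (bigID (fun b => lab b == U)) /=.
  rewrite big1 => [|b bU]; last by rewrite mxE bU mul0r.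
  rewrite add0r [X in _ = X - _](bigID (fun b => lab b == U)) /=.
  rewrite [X in _ = _ - X](_ : _ = \sum_(b | lab b == U) w 0 b * smx D i b a).
    by rewrite [RHS]addrAC subrr add0r; apply: eq_bigr => b /negbTE bU; rewrite mxE bU.
  rewrite -(big_sig_val (fun b => lab b == U) (fun b => w 0 b * smx D i b a)).
  by apply: eq_bigr => j _; rewrite !mxE.
(* A combination of the generators which is a coboundary gives, after lifting the
   primitive, a syzygy among them; its coordinates of degree U vanish. *)
- move=> c [u Zu cu].
  have [t tu] := syzygies_lift (P := fun B => (B \subset U) && (#|B|.+1 == #|U|))
    (fun B => fun H => let: conj BU cB := andP H in Zu B BU (eqP cB)).
  pose e : 'rV[K]_(srk D i.+1) := \sum_j c j *: delta_mx 0 (val j).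
  have tU a : cobd t U 0 a != 0 -> lab a \proper U.
    rewrite cobd_coord => ta; apply/negPn/negP => aU; case/eqP: ta.
    apply: big1 => x xU; rewrite [t _ 0 a](_ : _ = 0) ?scaler0 //; apply/eqP/negPn/negP => ta.
    have /tu[/(_ _ ta) + _] : (U :\ x \subset U) && (#|U :\ x|.+1 == #|U|).
      by rewrite subsetDl (cardsD1 x U) xU /=.
    by move/sub_proper_trans => /(_ U (properD1 xU)) /idP; rewrite (negbTE aU).
  have eb b : e 0 b = if insub b is Some j then c j else 0.
    rewrite summxE; case: insubP => [j bU jb|bU]; last first.
      apply: big1 => j _; rewrite !mxE eqxx /=; case: (b =P val j) => [bj|]; last by rewrite mulr0.
      by rewrite bj (valP j) in bU.
    rewrite (bigD1 j) //= !mxE jb !eqxx mulr1 big1 ?addr0 // => k kj.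
    rewrite !mxE eqxx /= -jb; case: (val j =P val k) => [/val_inj jk|]; last by rewrite mulr0.
    by rewrite jk eqxx in kj.
  have eU : @syzygies S D i.+1 U (e - cobd t U).
    split=> [a|].
      rewrite !mxE eb; case: insubP => [j /eqP-> //|_].
      by rewrite add0r oppr_eq0 => /tU/proper_sub.
    rewrite mulmxBl -cobd_mulmx; apply/eqP; rewrite subr_eq0; apply/eqP.
    transitivity (\sum_j c j *: row (val j) (smx D i)).
      by rewrite mulmx_suml; apply: eq_bigr => j _; rewrite -scalemxAl -rowE.
    rewrite (cu U) //; apply: eq_cobd => x xU.
    have /tu[_ ->//] : (U :\ x \subset U) && (#|U :\ x|.+1 == #|U|).
    by rewrite subsetDl (cardsD1 x U) xU /=.
  move=> j; apply/eqP/negPn/negP => cj.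
  have jU := valP j; have := syzygies_proper eU (a := val j).
  have /eqP t0 : cobd t U 0 (val j) == 0.
    by apply/negPn/negP => /tU; rewrite (eqP jU) properxx.
  by rewrite !mxE t0 subr0 eb valK (eqP jU) properxx => /(_ cj).
Qed.

(** The connecting isomorphism of the exact sequence from syzygies [i.+1] through
    the free module to syzygies [i]. A basis element [zs j] of size [q.+1] is the
    coboundary of some [ys j] in the free module, and the image of [ys j] under
    the differential is the new basis element. The free module contributes no
    cohomology: below size [#|U|] it is acyclic, and in size [#|U|] the elements
    at hand have proper supports. *)
Lemma dimension_shift i U q (J : finType) : (q < #|U|)%N ->
  cohom_basis (@syzygies S D i.+1) U q.+1 J -> cohom_basis (@syzygies S D i) U q J.
Proof.
move=> qU [zs [zs_cyc zs_gen zs_free]].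
pose G := in_strand (@lab D i.+1).
have [G0 GD GZ] := in_strand_submod (@lab D i.+1).
have [C0 CD CZ] := @syzygies_submod S D i.
have Zs := @syzygies_submod S D i.+1.
have ZG B v : @syzygies S D i.+1 B v -> G B v := @syzygies_in_strand i.+1 B v.
have zsG j : coboundary G U q.+1 (zs j).
  have [zsZ zs0] := zs_cyc j; apply: in_strand_acyclic => [|B a BU cB za].
    by split=> // B BU cB; apply/ZG/zsZ.
  have [/(_ B BU cB)/syzygies_proper/(_ za) aB _] := zs_cyc j.
  by apply: contraTneq (proper_sub_trans aB BU) => ->; rewrite properxx.
have [ys ysG ysE] := fin_all_exists2 zsG.
exists (fun j B => ys j B *m smx D i); split.
- move=> j; split=> [B BU cB|B BU cB]; first by apply/syzygies_gen/ysG; rewrite ?cB.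
  by rewrite cobd_mulmx -ysE //; have [/(_ B BU cB)[]] := zs_cyc j.
(* Lift the cocycle [w] to [y]; the coboundary of [y] is a cocycle of syzygies, and
   subtracting its expression leaves a cocycle [t] of the free module. *)
- move=> w [wZ w_cyc].
  have [y wy] := syzygies_lift (P := fun B => (B \subset U) && (#|B| == q))
    (fun B => fun H => let: conj BU cB := andP H in wZ B BU (eqP cB)).
  have yG B : B \subset U -> #|B| = q -> G B (y B).
    by move=> BU cB; have /wy[] : (B \subset U) && (#|B| == q) by rewrite BU cB eqxx.
  have yE B : B \subset U -> #|B| = q -> w B = y B *m smx D i.
    by move=> BU cB; have /wy[] : (B \subset U) && (#|B| == q) by rewrite BU cB eqxx.
  have : cocycle (@syzygies S D i.+1) U q.+1 (cobd y).
    split=> [B BU cB|B BU cB]; last exact: cobd_cobd.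
    split.
      apply: (cobd_in_strand _ BU) => C CU [] cC.
      by apply: yG => //; apply: succn_inj; rewrite -cB.
    rewrite -cobd_mulmx -(w_cyc B BU cB); apply: eq_cobd => x xB.
    rewrite yE //; first exact: subset_trans (subsetDl _ _) BU.
    by apply: succn_inj; rewrite -cB (cardsD1 x B) xB.
  case/zs_gen=> c [x xZ xE]; exists c.
  pose t B := y B - \sum_j c j *: ys j B - x B.
  have tG B : B \subset U -> #|B| = q -> G B (t B).
    move=> BU cB; apply: in_strandB; [apply: in_strandB|]; first exact: yG.
      by apply: in_strand_sum => j _; apply/GZ/ysG; rewrite ?cB.
    by apply/ZG/xZ; rewrite ?cB.
  have : coboundary G U q t.
    apply: in_strand_acyclic => [|B a BU cB /(tG B BU cB) aB].
      split=> // B BU cB; rewrite !(cobdD, cobdN) cobd_sum -xE //.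
      by under eq_bigr do rewrite -ysE //; rewrite subrr.
    by apply: contraTneq aB => ->; apply: contraL qU => /subset_leq_card; rewrite cB -leqNgt.
  move/coboundary_mulmx; apply: eq_coboundary => B BU cB.
  have /xZ[] := BU; first by rewrite cB.
  move=> _ xC; rewrite !mulmxBl xC subr0 yE // mulmx_suml; congr (_ - _).
  by apply: eq_bigr => j _; rewrite -scalemxAl.
(* If the combination bounds [u], lifted to [t], then the combination of the [ys j]
   differs from the coboundary of [t] by syzygies, which bound that of the [zs j]. *)
- move=> c [u uZ cu].
  have [t tu] := syzygies_lift (P := fun B => (B \subset U) && (#|B|.+1 == q))
    (fun B => fun H => let: conj BU cB := andP H in uZ B BU (eqP cB)).
  have tG B : B \subset U -> #|B|.+1 = q -> G B (t B).
    by move=> BU cB; have /tu[] : (B \subset U) && (#|B|.+1 == q) by rewrite BU cB eqxx.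
  have tE B : B \subset U -> #|B|.+1 = q -> u B = t B *m smx D i.
    by move=> BU cB; have /tu[] : (B \subset U) && (#|B|.+1 == q) by rewrite BU cB eqxx.
  apply: zs_free; exists (fun B => \sum_j c j *: ys j B - cobd t B) => B BU cB.
    split=> [|]; last first.
      rewrite mulmxBl -cobd_mulmx; apply/eqP; rewrite subr_eq0; apply/eqP.
      transitivity (\sum_j c j *: (ys j B *m smx D i)).
        by rewrite mulmx_suml; apply: eq_bigr => j _; rewrite -scalemxAl.
      have {}cB : #|B| = q by apply: succn_inj.
      rewrite cu //; apply: eq_cobd => x xB; rewrite tE //.
        exact: subset_trans (subsetDl _ _) BU.
      by rewrite -cB (cardsD1 x B) xB.
    apply: in_strandB; first by apply: in_strand_sum => j _; apply/GZ/ysG.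
    apply: (cobd_in_strand _ BU) => C CU cC.
    by apply: tG => //; rewrite cC; apply: succn_inj.
  rewrite cobdD cobdN cobd_cobd subr0 cobd_sum; apply: eq_bigr => j _; rewrite -ysE //.
Qed.

(** Hochster's formula: the number of basis elements of degree [U] depends on the
    complex only through the cohomology of the ideal on the subsets of [U]. *)
Lemma hochster i U : (i <= #|U|)%N ->
  cohom_basis (@syzygies S D 0) U (#|U| - i) {b : 'I_(srk D i.+1) | lab b == U}.
Proof.
move=> iU; have H k : (k <= i)%N ->
    cohom_basis (@syzygies S D (i - k)) U (#|U| - k) {b : 'I_(srk D i.+1) | lab b == U}.
  elim: k => [|k IH] ki; first by rewrite !subn0; apply: generators_basis.
  have kU := leq_trans ki iU.
  apply: dimension_shift; first by rewrite ltn_subrL (leq_trans _ kU).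
  by rewrite !subnSK //; apply/IH/ltnW.
by have := H i (leqnn i); rewrite subnn.
Qed.

End Hochster.
End Squarefree.
Arguments in_strand_delta {K X r} W b _.

(** * Existence of minimal squarefree resolutions *)

Section Existence.
Variables (K : fieldType) (X : finType).
Implicit Types (S : {set {set X}}) (B C U : {set X}).

(** One step of the construction: a labelled basis and, for every [U], the syzygies
    of degree [U] still to be generated. *)
Record stage := Stage {
  st_rk : nat;
  st_lab : 'I_st_rk -> {set X};
  st_syz : {set X} -> 'M[K]_st_rk
}.

(** A complement in degree [U] of the syzygies coming from smaller degrees: its
    bases are the minimal generators of degree [U]. *)
Definition new_syz (T : stage) U : 'M_(st_rk T) :=
  (st_syz T U :\: \sum_(B : {set X} | B \proper U) st_syz T B)%MS.

Definition gen_idx (T : stage) : finType := {U : {set X} & 'I_(\rank (new_syz T U))}.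

Definition syz_gens (T : stage) : 'M[K]_(#|gen_idx T|, st_rk T) :=
  \matrix_(b < #|gen_idx T|)
    row (tagged (enum_val b)) (row_base (new_syz T (tag (enum_val b)))).

(** The row space of this diagonal matrix is the strand of degree [U]. *)
Definition strand_mx r (W : 'I_r -> {set X}) U : 'M[K]_r :=
  diag_mx (\row_a (W a \subset U)%:R).

Definition next_lab (T : stage) (b : 'I_#|gen_idx T|) : {set X} := tag (enum_val b).

Definition next_stage (T : stage) : stage :=
  @Stage #|gen_idx T| (@next_lab T)
    (fun U => (kermx (syz_gens T) :&: strand_mx (@next_lab T) U)%MS).

(** The invariant of the construction; properness of the supports is the minimality
    of the step before. *)
Definition good_stage (T : stage) :=
  (forall U U', U \subset U' -> (st_syz T U <= st_syz T U')%MS) /\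
  (forall U (v : 'rV_(st_rk T)) a, (v <= st_syz T U)%MS -> v 0 a != 0 -> st_lab a \proper U).

Lemma sub_strand_mx r (W : 'I_r -> {set X}) U (v : 'rV_r) :
  (v <= strand_mx W U)%MS <-> in_strand W U v.
Proof.
split=> [/submxP[u ->] a|sv].
  by rewrite mul_mx_diag !mxE; case: (W a \subset U) => //; rewrite mulr0 eqxx.
apply/submxP; exists v; rewrite mul_mx_diag; apply/rowP=> a; rewrite !mxE.
case: (v 0 a =P 0) => [->|/eqP/sv->]; by rewrite ?mul0r ?mulr1.
Qed.

Lemma next_labP (T : stage) U (b : 'I_#|gen_idx T|) : next_lab b = U ->
  exists k : 'I_(\rank (new_syz T U)), b = enum_rank (Tagged (fun U => 'I_(\rank (new_syz T U))) k).
Proof.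
by move=> <-; rewrite /next_lab; case: (enum_val b) (esym (enum_valK b)) => U' k; exists k.
Qed.

Lemma sub_syz_gensP (T : stage) U (v : 'rV_(st_rk T)) :
  (v <= strand_mx (@next_lab T) U *m syz_gens T)%MS <->
  exists2 w, in_strand (@next_lab T) U w & v = w *m syz_gens T.
Proof.
split=> [/submxP[u ->]|[w /sub_strand_mx sw ->]]; last exact: submxMr.
by exists (u *m strand_mx (@next_lab T) U); rewrite ?mulmxA //; apply/sub_strand_mx/submxMl.
Qed.

Lemma strand_mxS r (W : 'I_r -> {set X}) U U' : U \subset U' ->
  (strand_mx W U <= strand_mx W U')%MS.
Proof.
move=> UU'; apply/row_subP=> i; apply/sub_strand_mx => a.
have /sub_strand_mx/[apply] : (row i (strand_mx W U) <= strand_mx W U)%MS by apply: row_sub.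
by move/subset_trans; apply.
Qed.

Lemma row_syz_gens_sub (T : stage) b : (row b (syz_gens T) <= new_syz T (next_lab b))%MS.
Proof. by rewrite rowK (submx_trans (row_sub _ _)) // eq_row_base. Qed.

Lemma new_syz_sub (T : stage) U : (new_syz T U <= st_syz T U)%MS.
Proof. exact: diffmxSl. Qed.

Section Step.
Variable T : stage.
Hypothesis Tgood : good_stage T.

Lemma new_syz_sub_gens U : (new_syz T U <= strand_mx (@next_lab T) U *m syz_gens T)%MS.
Proof.
rewrite -eq_row_base; apply/row_subP => k; apply/sub_syz_gensP.
pose b := enum_rank (Tagged (fun U => 'I_(\rank (new_syz T U))) k).
have bU : next_lab b = U by rewrite /next_lab enum_rankK.
exists (delta_mx 0 b) => [a|].
  by rewrite mxE eqxx /=; case: (a =P b) => [->|]; rewrite ?eqxx ?bU.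
by rewrite -rowE rowK /b enum_rankK.
Qed.

(** By induction on [#|U|], since the syzygies of degree [U] are the sum of the new
    ones and of those coming from proper subsets. *)
Lemma syz_gens_exact U (v : 'rV_(st_rk T)) : (v <= st_syz T U)%MS <->
  exists2 w, in_strand (@next_lab T) U w & v = w *m syz_gens T.
Proof.
case: Tgood => mono _; split=> [vZ|[w sw ->]]; last first.
  rewrite mulmx_sum_row; apply: summx_sub => b _.
  case: (w 0 b =P 0) => [->|/eqP/sw bU]; first by rewrite scale0r sub0mx.
  by apply/scalemx_sub/(submx_trans (row_syz_gens_sub b))/(submx_trans (new_syz_sub _ _))/mono.
apply/sub_syz_gensP; apply: submx_trans vZ _.
elim: {U}_.+1 {-2}U (ltnSn #|U|) => // n IH U; rewrite ltnS => Un.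
rewrite -(addsmx_diff_cap_eq (st_syz T U) (\sum_(B : {set X} | B \proper U) st_syz T B)%MS).
rewrite addsmx_sub new_syz_sub_gens /=; apply: submx_trans (capmxSr _ _) _.
apply/sumsmx_subP => B BU; apply: submx_trans (IH B _) _.
  exact: leq_trans (proper_card BU) Un.
exact/submxMr/strand_mxS/proper_sub.
Qed.

(** Minimality of the next step. If a relation among the generators involved one of
    degree [U], then the part of degree [U] would be a combination of the new
    syzygies lying in the sum of the smaller degrees, hence zero; but a row base is
    free. *)
Lemma next_good : good_stage (next_stage T).
Proof.
split=> [U U' UU'|U v b]; first exact: capmxS (submx_refl _) (strand_mxS _ UU').
rewrite /= sub_capmx => /andP[/sub_kermxP v0 /sub_strand_mx sv] vb.
rewrite properEneq sv // andbT; apply/negP => /eqP bU.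
pose e k := enum_rank (Tagged (fun U => 'I_(\rank (new_syz T U))) k) : 'I_#|gen_idx T|.
pose x := \row_(k < \rank (new_syz T U)) v 0 (e U k).
have sumx : x *m row_base (new_syz T U) = \sum_(b | next_lab b == U) v 0 b *: row b (syz_gens T).
  rewrite mulmx_sum_row [RHS]big_mkcond [RHS](reindex enum_rank) /=;
    last exact/onW_bij/enum_rank_bij.
  pose f U' (k : 'I_(\rank (new_syz T U'))) := if next_lab (e U' k) == U
    then v 0 (e U' k) *: row (e U' k) (syz_gens T) else 0.
  transitivity (\sum_(p : gen_idx T) f (tag p) (tagged p)); last by apply: eq_bigr => -[].
  rewrite -(sig_big_dep predT (fun _ => predT) f) /f /=.
  rewrite (bigD1 U) //= [X in _ = _ + X]big1 ?addr0 => [|U' /negbTE U'U].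
    by apply: eq_bigr => k _; rewrite /next_lab enum_rankK eqxx mxE /e rowK enum_rankK.
  by apply: big1 => k _; rewrite /next_lab enum_rankK U'U.
have x0 : x *m row_base (new_syz T U) = 0.
  apply/eqP; rewrite -submx0.
  rewrite -(capmx_diff (st_syz T U) (\sum_(B : {set X} | B \proper U) st_syz T B)%MS).
  have xN : (x *m row_base (new_syz T U) <= new_syz T U)%MS.
    by rewrite (submx_trans (submxMl _ _)) ?eq_row_base.
  rewrite sub_capmx {}xN /= sumx.
  have /eqP := v0; rewrite mulmx_sum_row (bigID (fun b => next_lab b == U)) /= addr_eq0 => /eqP->.
  rewrite -scaleN1r; apply/scalemx_sub/summx_sub => c cU.
  case: (v 0 c =P 0) => [->|/eqP/sv cU']; first by rewrite scale0r sub0mx.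
  apply/scalemx_sub/(submx_trans (row_syz_gens_sub c))/(submx_trans (new_syz_sub _ _)).
  by apply: (sumsmx_sup (next_lab c)) => //; rewrite properEneq cU.
have x00 : x = 0 by apply: (row_free_inj (row_base_free (new_syz T U))); rewrite x0 mul0mx.
have [k bE] := next_labP bU.
by case/eqP: vb; rewrite bE; have /rowP/(_ k) := x00; rewrite !mxE.
Qed.
End Step.

Section Resolution.
Variable S : {set {set X}}.
Hypotheses (S_down : down_closed S) (S0 : set0 \in S).

Definition stage0 : stage :=
  @Stage 1 (fun _ => set0) (fun U => if U \in S then 0 else 1%:M).

Lemma stage0_good : good_stage stage0.
Proof.
split=> [U U' UU'|U v a] /=.
  by case: ifP => US; [exact: sub0mx|case: ifP => // /S_down/(_ UU'); rewrite US].
case: ifP => [_|/negbT US _ _]; first by rewrite submx0 => /eqP->; rewrite mxE eqxx.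
by rewrite proper0; apply: contraNneq US => ->.
Qed.

Fixpoint stages i := if i is j.+1 then next_stage (stages j) else stage0.

Definition minimal_squarefree : squarefree_complex K X :=
  @SquarefreeComplex K X (fun i => st_rk (stages i)) (fun i => @st_lab (stages i))
    (fun i => syz_gens (stages i)).

Lemma minimal_squarefreeP : squarefree_resolution S minimal_squarefree.
Proof.
have good i : good_stage (stages i) by case: i => [|i]; [exact: stage0_good|exact: next_good].
have syzE i U v : @syzygies K X S minimal_squarefree i U v <-> (v <= st_syz (stages i) U)%MS.
  case: i v => [|i] v /=.
    by case: ifP => _; rewrite ?submx0 ?submx1; split=> // [/(_ isT)/eqP|/eqP].
  rewrite sub_capmx; split=> [[sv /sub_kermxP->]|/andP[/sub_kermxP v0 /sub_strand_mx sv]] //.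
  exact/sub_strand_mx.
split=> // [i U v|i b a Cba]; first by rewrite syzE; apply: syz_gens_exact.
have [_ prop] := good i.
have := prop (next_lab b) (row b (syz_gens (stages i))) a.
rewrite (submx_trans (row_syz_gens_sub b)) ?new_syz_sub // mxE => /(_ isT Cba).
by move=> ab; apply: contraTneq ab => /= ->; rewrite properxx.
Qed.

End Resolution.
End Existence.

(** * Free resolutions over the polynomial ring from squarefree complexes *)

Section Strands.
Variables (K : fieldType) (X : finType).
Implicit Types (S : {set {set X}}) (A B C U : {set X}) (m : 'X_{1..#|X|}).
Local Notation R := {mpoly K[#|X|]}.

(** The exponent of the squarefree monomial of [A]. *)
Definition chi A : 'X_{1..#|X|} := [multinom (enum_val i \in A : nat) | i < #|X|].
Definition supp m : {set X} := [set x | m (enum_rank x) != 0%N].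

Lemma chi_le A m : (chi A <= m)%MM = (A \subset supp m).
Proof.
apply/mnm_lepP/subsetP => [le x xA|sub i].
  by rewrite inE -lt0n (leq_trans _ (le _)) // mnmE enum_rankK xA.
rewrite mnmE; case: (boolP (enum_val i \in A)) => // /sub; by rewrite inE enum_valK lt0n.
Qed.

Lemma mdeg_chi A : mdeg (chi A) = #|A|.
Proof.
rewrite mdegE -sum1_card; under eq_bigr do rewrite mnmE.
rewrite -(big_enum_val (fun x : X => (x \in A : nat))) /=.
by rewrite [RHS]big_mkcond; apply: eq_bigr => x _; case: (x \in A).
Qed.

Lemma chiD A B : A \subset B -> (chi A + chi (B :\: A))%MM = chi B.
Proof.
move=> /subsetP AB; apply/mnmP=> i; rewrite !mnmE !inE.
by case: (boolP (_ \in A)) => [/AB->|_] //=; rewrite addn0.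
Qed.

Lemma face_monomialE A : face_monomial K A = 'X_[chi A].
Proof.
rewrite /face_monomial mprodXE; congr mpolyX; apply/mnmP=> i.
rewrite mnm_sumE mnmE; under eq_bigr do rewrite mnm1E.
rewrite big_mkcond (bigD1 (enum_val i)) //= enum_valK eqxx big1 ?addn0 => [|x xi].
  by case: ifP.
by case: ifP => // _; apply/eqP; rewrite eqb0; apply: contraNneq xi => <-; rewrite enum_rankK.
Qed.

Lemma mcoeff_mulX (p : R) k m :
  (p * 'X_[k])@_m = if (k <= m)%MM then p@_(m - k) else 0.
Proof.
case: ifP => [km|/negbT km]; first by rewrite -[in LHS](submK km) addmC mcoeffMX.
apply/eqP; rewrite mcoeff_eq0 (perm_mem (msuppMX _ _)).
by apply/mapP => -[m' _ mE]; rewrite mE lem_addr in km.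
Qed.

Lemma in_SR_idealP S (f : R) : down_closed S ->
  in_SR_ideal S f <-> forall m, f@_m != 0 -> supp m \notin S.
Proof.
move=> S_down; split=> [[c ->] m|fS].
  rewrite raddf_sum /= => cm; apply/negP => mS; case/eqP: cm; apply: big1 => A AS.
  rewrite face_monomialE mcoeff_mulX chi_le; case: ifP => // Am.
  by case/negP: AS; apply: S_down mS Am.
exists (fun A => \sum_(m <- msupp f | supp m == A) f@_m *: 'X_[m - chi A]).
rewrite {1}(mpolyE f) big_seq_cond (partition_big supp (fun A => A \notin S)) /=; last first.
  by move=> m /andP[+ _]; rewrite mcoeff_msupp => /fS.
apply: eq_bigr => A AS; rewrite mulr_suml [RHS]big_seq_cond.
apply: eq_big => [m|m /andP[_ /eqP mA]]; first by rewrite andbT.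
by rewrite face_monomialE -scalerAl -mpolyXD submK // chi_le mA.
Qed.

Section Rows.
Variables (r : nat) (W : 'I_r -> {set X}).
Implicit Types v : 'rV[R]_r.

(** The component of multidegree [m] of a vector of polynomials, read in the strand
    of degree [supp m]: the coefficient of the multiple of degree [m] of each basis
    element. *)
Definition mstrand v m : 'rV[K]_r :=
  \row_a if W a \subset supp m then (v 0 a)@_(m - chi (W a)) else 0.

Lemma mstrandP v m : in_strand W (supp m) (mstrand v m).
Proof. by move=> a; rewrite mxE; case: ifP => //; rewrite eqxx. Qed.

Lemma mstrand_inj v v' : (forall m, mstrand v m = mstrand v' m) -> v = v'.
Proof.
move=> vv; apply/rowP=> a; apply/mpolyP => m.
have := congr1 (fun u : 'rV_r => u 0 a) (vv (m + chi (W a))%MM).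
by rewrite !mxE -chi_le lem_addl addmK.
Qed.

Definition multidegs v : seq 'X_{1..#|X|} :=
  [seq (m + chi (W a))%MM | a <- enum 'I_r, m <- msupp (v 0 a)].

Lemma mstrand_out v m : m \notin multidegs v -> mstrand v m = 0.
Proof.
move=> mv; apply/rowP=> a; rewrite !mxE; case: ifP => // Wm; apply/eqP.
rewrite mcoeff_eq0; apply: contra mv => mv.
by apply/allpairsPdep; exists a, (m - chi (W a))%MM; rewrite mem_enum submK // chi_le.
Qed.

(** Prescribed components in finitely many multidegrees come from a vector: the
    condition on the supports makes every monomial quotient exist. *)
Lemma mstrand_surj (ms : seq 'X_{1..#|X|}) (u : 'X_{1..#|X|} -> 'rV[K]_r) :
  (forall m, m \in ms -> in_strand W (supp m) (u m)) ->
  exists w, forall m, mstrand w m = if m \in ms then u m else 0.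
Proof.
move=> uW; pose w := \row_a \sum_(m <- undup ms) (u m 0 a) *: 'X_[K, m - chi (W a)].
exists w => m; apply/rowP=> a; rewrite !mxE raddf_sum /=.
case: ifP => [Wm|/negbT Wm]; last first.
  case: ifP => [mm|]; last by rewrite mxE.
  by apply/eqP; rewrite eq_sym; apply/negPn/negP => /uW; rewrite (negbTE Wm) => /(_ mm).
rewrite (eq_big_seq (fun m' => if m' == m then u m 0 a else 0)).
  case: ifP => mm; last first.
    rewrite big_seq big1 ?mxE // => m'; rewrite mem_undup.
    by case: eqP => // ->; rewrite mm.
  by rewrite (bigD1_seq m) ?undup_uniq ?mem_undup //= eqxx big1 ?addr0 // => m' /negbTE->.
move=> m'; rewrite mem_undup => m'm; rewrite mcoeffZ mcoeffX.
case: (m' =P m) => [->|mm']; first by rewrite eqxx mulr1.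
case: (u m' 0 a =P 0) => [->|/eqP/(uW m' m'm) Wm']; first by rewrite mul0r.
case: eqP => [E|]; last by rewrite mulr0.
by case: mm'; rewrite -(@submK _ (chi (W a)) m') ?chi_le // E submK ?chi_le.
Qed.

End Rows.

Lemma lem_subr_add k1 k2 m : (k1 <= m)%MM -> (k2 <= m - k1)%MM = (k1 + k2 <= m)%MM.
Proof.
move=> /mnm_lepP k1m; apply/mnm_lepP/mnm_lepP => le i; have := le i; have := k1m i;
  by rewrite mnmBE mnmDE => k1i; rewrite leq_subRL.
Qed.

Definition monomial_mx r r' (W : 'I_r -> {set X}) (W' : 'I_r' -> {set X})
    (C : 'M[K]_(r', r)) : 'M[R]_(r', r) :=
  \matrix_(b, a) (C b a *: 'X_[chi (W' b :\: W a)]).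

(** Taking components turns the matrix of monomials into the scalar matrix. *)
Lemma mstrand_mul r r' (W : 'I_r -> {set X}) (W' : 'I_r' -> {set X}) (C : 'M[K]_(r', r)) v m :
  (forall b a, C b a != 0 -> W a \subset W' b) ->
  mstrand W (v *m monomial_mx W W' C) m = mstrand W' v m *m C.
Proof.
move=> WC; apply/rowP=> a; rewrite !mxE raddf_sum /=.
transitivity (\sum_b (if W a \subset supp m then
   (v 0 b * monomial_mx W W' C b a)@_(m - chi (W a)) else 0)).
  by case: ifP => // _; rewrite big1.
apply: eq_bigr => b _; rewrite !mxE -scalerAr mcoeffZ.
case: (C b a =P 0) => [->|/eqP/WC ab]; first by rewrite mul0r mulr0; case: ifP.
case: ifP => [am|am]; last first.
  by case: ifP => [/(subset_trans ab)|]; rewrite ?am ?mul0r.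
rewrite mcoeff_mulX lem_subr_add ?chi_le // submDA chiD // chi_le mulrC.
by case: (W' b \subset supp m).
Qed.

Section Realization.
Variables (S : {set {set X}}) (D : squarefree_complex K X).
Hypothesis S_down : down_closed S.
Hypothesis Dres : squarefree_resolution S D.

Definition realize : free_complex K X :=
  @FreeComplex K X (srk D) (fun i a => #|lab a|) (const_mx 1)
    (fun i => monomial_mx (@lab K X D i) (@lab K X D i.+1) (smx D i)).

Lemma mstrand_dif i v m :
  mstrand (@lab K X D i) (v *m dif realize i) m = mstrand (@lab K X D i.+1) v m *m smx D i.
Proof. by apply: mstrand_mul => b a /(lab_proper Dres)/proper_sub. Qed.

(** A vector of polynomials is a boundary if and only if each of its finitely many
    nonzero components is, and for these exactness of the strands applies. *)
Lemma image_dif i (v : 'rV[R]_(srk D i)) : (exists w, v = w *m dif realize i) <->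
  forall m, @syzygies K X S D i (supp m) (mstrand (@lab K X D i) v m).
Proof.
split=> [[w ->] m|vZ].
  by rewrite mstrand_dif; apply/(syzygies_gen Dres)/mstrandP.
have lift (ms : seq 'X_{1..#|X|}) : exists u : 'X_{1..#|X|} -> 'rV[K]_(srk D i.+1),
    forall m, m \in ms -> in_strand (@lab K X D i.+1) (supp m) (u m) /\
      mstrand (@lab K X D i) v m = u m *m smx D i.
  elim: ms => [|m ms [u uP]]; first by exists (fun _ => 0).
  case: Dres => _ _ ex _; have /ex[w sw wE] := vZ m.
  exists (fun m' => if m' == m then w else u m') => m'.
  by rewrite inE; case: eqP => [->|_ /uP].
have [u uP] := lift (multidegs (@lab K X D i) v).
have [w wE] := mstrand_surj (fun m mm => (uP m mm).1).
exists w; apply: (mstrand_inj (W := @lab K X D i)) => m; rewrite mstrand_dif wE.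
by case: ifP => [/uP[]//|/negbT/mstrand_out->]; rewrite mul0mx.
Qed.

Lemma realize_resolution : minimal_free_resolution S realize.
Proof.
have [r0 lab0 ex mn] := Dres.
pose a0 : 'I_(srk D 0) := cast_ord (esym r0) ord0.
have a0E a : a = a0.
  by apply/val_inj; case: a => [[|k] ak] //=; exfalso; move: ak; rewrite r0.
have augE (v : 'rV[R]_(srk D 0)) : (v *m aug realize) 0 0 = v 0 a0.
  rewrite mxE (bigD1 a0) //= big1 ?addr0 ?mxE ?mulr1 // => a.
  by rewrite (a0E a) eqxx.
have chi0 : chi set0 = 0%MM by apply/eqP; rewrite -mdeg_eq0 mdeg_chi cards0.
split; last 1 first.
- move=> i b a; rewrite !mxE mcoeffZ mcoeffX.
  case: (smx D i b a =P 0) => [->|/eqP/(lab_proper Dres)]; first by rewrite mul0r.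
  rewrite properE => /andP[_ ba]; rewrite -mdeg_eq0 mdeg_chi cards_eq0 setD_eq0.
  by rewrite (negbTE ba) mulr0.
- split=> [a m|i b a m].
    by rewrite mxE msupp1 inE => /eqP->; rewrite mdeg0 /= lab0 cards0.
  rewrite mxE; have [->|nz] := eqVneq (smx D i b a) 0; first by rewrite scale0r msupp0.
  rewrite msuppMCX // inE => /eqP->; rewrite /= -!mdeg_chi -mdegD addmC chiD //.
  exact/proper_sub/(lab_proper Dres).
split=> [f|v|i v].
- exists (\row_a f); rewrite augE mxE subrr; apply/in_SR_idealP => // m.
  by rewrite mcoeff0 eqxx.
- rewrite image_dif in_SR_idealP //= augE.
  have vE m : (mstrand (@lab K X D 0) v m = 0) <-> (v 0 a0)@_m = 0.
    split=> [/rowP/(_ a0)|v0]; first by rewrite !mxE lab0 sub0set chi0 subm0.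
    by apply/rowP=> a; rewrite (a0E a) !mxE lab0 sub0set chi0 subm0.
  split=> H m; first by move=> mS; apply/vE/eqP; apply: contraLR mS => /H.
  by apply: contraNN => /H/vE->.
rewrite image_dif; split=> [v0 m|H].
  split; first exact: mstrandP.
  by rewrite -mstrand_dif v0; apply/rowP=> a; rewrite !mxE mcoeff0; case: ifP.
apply: (mstrand_inj (W := @lab K X D i)) => m; rewrite mstrand_dif.
by have [_ ->] := H m; apply/rowP=> a; rewrite !mxE mcoeff0; case: ifP.
Qed.

End Realization.
End Strands.

(** * Uniqueness of graded Betti numbers *)

Section Uniqueness.
Variables (K : fieldType) (X : finType).
Local Notation R := {mpoly K[#|X|]}.
Implicit Types (p q f : R) (m : 'X_{1..#|X|}).

(** The component of [p] for which [homog_entry D d] holds. *)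
Definition homog_comp (D d : nat) p : R :=
  \sum_(m <- msupp p | (mdeg m + d)%N == D) p@_m *: 'X_[m].

Lemma mcoeff_homog_comp D d p m :
  (homog_comp D d p)@_m = if (mdeg m + d)%N == D then p@_m else 0.
Proof.
rewrite raddf_sum /= big_mkcond /=.
transitivity (\sum_(k <- msupp p) if k == m then
   (if (mdeg m + d)%N == D then p@_m else 0) else 0).
  apply: eq_bigr => k _; rewrite mcoeffZ mcoeffX.
  by have [->|_] := eqVneq k m; case: ifP; rewrite ?mulr1 ?mulr0.
have [mp|mp] := boolP (m \in msupp p).
  by rewrite (bigD1_seq m) //= eqxx big1 ?addr0 // => k /negbTE->.
rewrite (memN_msupp_eq0 mp) if_same big1_seq // => k /= kp; by rewrite if_same.
Qed.

Lemma homog_comp_homog D d p : homog_entry D d (homog_comp D d p).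
Proof. by move=> m; rewrite mcoeff_msupp mcoeff_homog_comp; case: (_ =P D); rewrite ?eqxx. Qed.

Lemma homog_compP D d p : homog_entry D d p <-> homog_comp D d p = p.
Proof.
split=> [hp|<-]; last exact: homog_comp_homog.
apply/mpolyP=> m; rewrite mcoeff_homog_comp; case: ifP => // mD.
apply/esym/eqP/negPn/negP; rewrite -mcoeff_msupp => /hp /eqP; by rewrite mD.
Qed.

Lemma homog_compB D d : {morph homog_comp D d : p q / p - q}.
Proof.
move=> p q; apply/mpolyP=> m; rewrite mcoeffB !mcoeff_homog_comp mcoeffB.
by case: ifP => //; rewrite subr0.
Qed.

Lemma homog_comp_sum D d (I : finType) (F : I -> R) :
  homog_comp D d (\sum_i F i) = \sum_i homog_comp D d (F i).
Proof.
apply/mpolyP=> m; rewrite mcoeff_homog_comp !raddf_sum /=.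
under [RHS]eq_bigr do rewrite mcoeff_homog_comp.
by case: ifP => // _; rewrite big1.
Qed.

Lemma homog_comp_mul D d d0 p q : homog_entry d d0 q ->
  homog_comp D d p * q = homog_comp D d0 (p * q).
Proof.
move=> hq; apply/mpolyP=> k; rewrite mcoeff_homog_comp [in LHS](mpolyE q) [in RHS](mpolyE q).
rewrite !mulr_sumr !raddf_sum /=.
transitivity (\sum_(m <- msupp q) if (mdeg k + d0)%N == D then (p * (q@_m *: 'X_[m]))@_k else 0);
  last by case: ifP => // _; rewrite big1.
apply: eq_big_seq => m /hq md; rewrite -!scalerAr !mcoeffZ !mcoeff_mulX.
case: ifP => mk; last by rewrite mulr0 if_same.
have -> : mdeg k = (mdeg (k - m) + mdeg m)%N by rewrite -mdegD submK.
rewrite mcoeff_homog_comp -addnA md.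
by case: ifP; rewrite ?mulr0.
Qed.

Definition homog_mx r s (dr : 'I_r -> nat) (ds : 'I_s -> nat) (M : 'M[R]_(r, s)) :=
  forall i j, homog_entry (dr i) (ds j) (M i j).

Lemma homog_mx_mul r s t (dr : 'I_r -> nat) (ds : 'I_s -> nat) (dt : 'I_t -> nat) M N :
  homog_mx dr ds M -> homog_mx ds dt N -> homog_mx dr dt (M *m N).
Proof.
move=> hM hN i j; apply/homog_compP; rewrite mxE homog_comp_sum; apply: eq_bigr => k _.
by rewrite -(homog_comp_mul _ _ (hN k j)) (iffLR (homog_compP _ _ _) (hM i k)).
Qed.

Lemma homog_comp_mulmx r s (dr : 'I_r -> nat) (ds : 'I_s -> nat) (M : 'M[R]_(r, s)) D
    (v : 'rV[R]_r) j : homog_mx dr ds M ->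
  ((\row_i homog_comp D (dr i) (v 0 i)) *m M) 0 j = homog_comp D (ds j) ((v *m M) 0 j).
Proof.
move=> hM; rewrite !mxE homog_comp_sum; apply: eq_bigr => i _.
by rewrite mxE (homog_comp_mul _ _ (hM i j)).
Qed.

(** A lift of a homogeneous matrix through a homogeneous matrix may be chosen
    homogeneous: keep the components of the right degree of any lift. *)
Lemma homog_mx_lift r s t (dr : 'I_r -> nat) (ds : 'I_s -> nat) (dt : 'I_t -> nat)
    (M : 'M[R]_(r, s)) (N : 'M[R]_(t, s)) :
  homog_mx dr ds M -> homog_mx dt ds N -> (forall i, exists w, row i M = w *m N) ->
  exists2 L, homog_mx dr dt L & M = L *m N.
Proof.
move=> hM hN /fin_all_exists[w wE].
exists (\matrix_(i, k) homog_comp (dr i) (dt k) (w i 0 k)) => [i k|].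
  by rewrite mxE; apply: homog_comp_homog.
apply/row_matrixP => i; rewrite row_mul.
have -> : row i (\matrix_(i, k) homog_comp (dr i) (dt k) (w i 0 k)) =
  \row_k homog_comp (dr i) (dt k) (w i 0 k) by apply/rowP=> k; rewrite !mxE.
apply/rowP=> j; rewrite (homog_comp_mulmx _ _ _ hN) -wE mxE.
by rewrite (iffLR (homog_compP _ _ _) (hM i j)).
Qed.

Lemma lift_rows r s t (M : 'M[R]_(r, s)) (N : 'M[R]_(t, s)) :
  (forall i, exists w, row i M = w *m N) -> exists L, M = L *m N.
Proof.
move=> /fin_all_exists[w wE]; exists (\matrix_i w i).
by apply/row_matrixP => i; rewrite row_mul rowK.
Qed.

Lemma homog_comp_SR_ideal (S : {set {set X}}) D d f :
  down_closed S ->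
  in_SR_ideal S f -> in_SR_ideal S (homog_comp D d f).
Proof.
move=> S_down; rewrite !in_SR_idealP // => fS m; rewrite mcoeff_homog_comp.
by case: ifP => [_ /fS|]; rewrite ?eqxx.
Qed.

Section Comparison.
Variables (S : {set {set X}}) (F G : free_complex K X).
Hypothesis S_down : down_closed S.
Hypotheses (FS : minimal_free_resolution S F) (GS : minimal_free_resolution S G).

(** Stage [i] of the comparison of two resolutions: homogeneous maps [phi] and
    [psi] in both directions, sending boundaries to boundaries, and a homotopy
    from their composite to the identity. The term [t] stands for the differential
    of step [i - 1] followed by the homotopy of that step; only its two properties
    are kept, so that the induction does not refer to earlier stages. *)
Definition comparison_at i := exists (phi : 'M[R]_(rk F i, rk G i)) (psi : 'M[R]_(rk G i, rk F i))
    (h : 'M[R]_(rk F i, rk F i.+1)) (t : 'M[R]_(rk F i, rk F i)),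
  [/\ homog_mx (@deg K X F i) (@deg K X G i) phi /\ homog_mx (@deg K X G i) (@deg K X F i) psi,
      forall v : 'rV_(rk F i.+1), exists w, v *m dif F i *m phi = w *m dif G i,
      forall v : 'rV_(rk G i.+1), exists w, v *m dif G i *m psi = w *m dif F i,
      phi *m psi = 1%:M + h *m dif F i + t
    & dif F i *m t = 0 /\ forall a b, (t a b)@_0%MM = 0].

End Comparison.

Section Augmentation.
Variables (S : {set {set X}}).
Hypothesis S_down : down_closed S.

Lemma in_SR_ideal0 : in_SR_ideal S (0 : R).
Proof. by apply/in_SR_idealP => // m; rewrite mcoeff0 eqxx. Qed.

Lemma in_SR_idealB f g : in_SR_ideal S f -> in_SR_ideal S g -> in_SR_ideal S (f - g).
Proof.
rewrite !in_SR_idealP // => fS gS m; rewrite mcoeffB.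
by have [f0|/fS//] := eqVneq f@_m 0; rewrite f0 sub0r oppr_eq0 => /gS.
Qed.

Lemma in_SR_ideal_sum (I : finType) (c : I -> R) (g : I -> R) :
  (forall i, in_SR_ideal S (g i)) -> in_SR_ideal S (\sum_i c i * g i).
Proof.
move=> gS; apply/in_SR_idealP => // m; rewrite raddf_sum /= => cm.
have [i] : exists i, (c i * g i)@_m != 0.
  apply/existsP; apply: contraNT cm; rewrite negb_exists => /forallP c0.
  by rewrite big1 // => i _; apply/eqP/negPn/c0.
have [e gE] := gS i.
rewrite {1}gE mulr_sumr raddf_sum /= => em.
have [A AS] : exists2 A, A \notin S & (c i * (e A * face_monomial K A))@_m != 0.
  apply/exists_inP; apply: contraNT em => /exists_inPn c0.
  by rewrite big1 // => A /c0/negPn/eqP.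
rewrite face_monomialE mulrA mcoeff_mulX chi_le; case: ifP => [Am _|]; last by rewrite eqxx.
by apply: contra AS => /S_down; apply.
Qed.

Lemma comparison_start (F G : free_complex K X) :
  minimal_free_resolution S F -> minimal_free_resolution S G ->
  exists2 phi : 'M[R]_(rk F 0, rk G 0), homog_mx (@deg K X F 0) (@deg K X G 0) phi &
    forall v : 'rV_(rk F 0), in_SR_ideal S ((v *m aug F - v *m phi *m aug G) 0 0).
Proof.
move=> [[augF _] _ _] [[augG _] [gen _ _] _].
have hG : homog_mx (@deg K X G 0) (fun _ : 'I_1 => 0%N) (aug G) by move=> a j; rewrite (ord1 j).
have [w wE] := fin_all_exists (fun a => gen (aug F a 0)).
pose phi := \matrix_(i, k) homog_comp (deg i) (deg k) (w i 0 k) : 'M[R]_(rk F 0, rk G 0).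
exists phi => [i k|v].
  by rewrite mxE; apply: homog_comp_homog.
have phiE a : in_SR_ideal S (aug F a 0 - (row a phi *m aug G) 0 0).
  have -> : row a phi = \row_k homog_comp (deg a) (deg k) (w a 0 k) by apply/rowP=> k; rewrite !mxE.
  rewrite (homog_comp_mulmx _ _ _ hG) -(iffLR (homog_compP _ _ _) (augF a)) -homog_compB.
  exact: homog_comp_SR_ideal.
have -> : (v *m aug F - v *m phi *m aug G) 0 0
    = \sum_a v 0 a * (aug F a 0 - (row a phi *m aug G) 0 0).
  rewrite -mulmxA -mulmxBr mxE; apply: eq_bigr => a _.
  by rewrite -row_mul !mxE.
exact: in_SR_ideal_sum.
Qed.

(** The usual construction of chain maps and homotopies between resolutions;
    minimality of [F] makes the constant terms of [t] vanish. *)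
Lemma comparison (F G : free_complex K X) i :
  minimal_free_resolution S F -> minimal_free_resolution S G ->
  comparison_at F G i.
Proof.
move=> FS GS; have [[augF hF] [genF imF kerF] mnF] := FS.
have [[augG hG] [genG imG kerG] mnG] := GS.
have dd (H : free_complex K X) : resolves S H -> forall i, dif H i.+1 *m dif H i = 0.
  case=> _ _ ker j; apply/row_matrixP => b; rewrite row_mul row0.
  by apply/ker; exists (delta_mx 0 b); rewrite -rowE.
elim: i => [|i [phi [psi [h [t [[hphi hpsi] imphi impsi phipsi [dt t0]]]]]]].
  have [phi hphi phiE] := comparison_start FS GS; have [psi hpsi psiE] := comparison_start GS FS.
  have im0 (H H' : free_complex K X) (f : 'M[R]_(rk H 0, rk H' 0)) :
      resolves S H -> resolves S H' ->
      (forall v : 'rV_(rk H 0), in_SR_ideal S ((v *m aug H - v *m f *m aug H') 0 0)) ->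
      forall v : 'rV_(rk H 1), exists w, v *m dif H 0 *m f = w *m dif H' 0.
    move=> [_ imH _] [_ imH' _] fE v; apply/imH'.
    have vI : in_SR_ideal S ((v *m dif H 0 *m aug H) 0 0) by apply/imH; exists v.
    have := in_SR_idealB vI (fE (v *m dif H 0)).
    by rewrite [X in _ - X]mxE [X in _ - (_ + X)]mxE opprB addrC subrK.
  have [h hE] : exists h, phi *m psi - 1%:M = h *m dif F 0.
    apply: lift_rows => a; apply/imF.
    have -> : row a (phi *m psi - 1%:M) *m aug F =
        0 - (delta_mx 0 a *m aug F - delta_mx 0 a *m phi *m aug G)
          - (delta_mx 0 a *m phi *m aug G - delta_mx 0 a *m phi *m psi *m aug F).
      rewrite rowE mulmxBr mulmx1 mulmxBl mulmxA sub0r !opprB.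
      by rewrite [RHS]addrC addrA subrK.
    have entryB (M N : 'M[R]_1) : (M - N) 0 0 = M 0 0 - N 0 0 by rewrite !mxE.
    rewrite 2!entryB; apply: in_SR_idealB (psiE _); apply: in_SR_idealB (phiE _).
    by rewrite mxE; apply: in_SR_ideal0.
  exists phi, psi, h, 0; split=> //.
  - exact: im0.
  - exact: im0.
  - by rewrite addr0 -hE addrC subrK.
  - by split=> [|a b]; rewrite ?mulmx0 // mxE mcoeff0.
have [phi' hphi' phi'E] : exists2 L, homog_mx (@deg K X F i.+1) (@deg K X G i.+1) L &
    dif F i *m phi = L *m dif G i.
  apply: homog_mx_lift; first exact: homog_mx_mul (hF i) hphi.
    exact: hG.
  by move=> b; have [w wE] := imphi (delta_mx 0 b); exists w; rewrite row_mul rowE.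
have [psi' hpsi' psi'E] : exists2 L, homog_mx (@deg K X G i.+1) (@deg K X F i.+1) L &
    dif G i *m psi = L *m dif F i.
  apply: homog_mx_lift; first exact: homog_mx_mul (hG i) hpsi.
    exact: hF.
  by move=> b; have [w wE] := impsi (delta_mx 0 b); exists w; rewrite row_mul rowE.
have [h' h'E] : exists h', phi' *m psi' - 1%:M - dif F i *m h = h' *m dif F i.+1.
  apply: lift_rows => a; apply/kerF; rewrite -row_mul !mulmxBl mul1mx -!mulmxA -psi'E.
  rewrite !mulmxA -phi'E -[_ *m phi *m psi]mulmxA phipsi !mulmxDr mulmx1 dt addr0 mulmxA.
  by rewrite -addrA -opprD subrr row0.
exists phi', psi', h', (dif F i *m h); split=> //.
- move=> v; apply/kerG; rewrite -mulmxA -phi'E mulmxA -[v *m _ *m _]mulmxA.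
  by rewrite dd ?mulmx0 ?mul0mx //; case: FS.
- move=> v; apply/kerF; rewrite -mulmxA -psi'E mulmxA -[v *m _ *m _]mulmxA.
  by rewrite dd ?mulmx0 ?mul0mx //; case: GS.
- by rewrite -h'E -addrA subrK addrC subrK.
- split=> [|a b]; first by rewrite mulmxA dd ?mul0mx //; case: FS.
  by rewrite mxE raddf_sum big1 //= => c _; rewrite rmorphM /= mnF mul0r.
Qed.

(** Constant terms turn the homotopy into an identity: the matrices of constant
    terms of [phi] and [psi] are inverse to each other on one side. A nonzero
    constant entry joins basis elements of equal degree, so the identity holds for
    the blocks of each degree [j], and ranks compare the sizes. *)
Lemma betti_number_le (F G : free_complex K X) i j :
  minimal_free_resolution S F -> minimal_free_resolution S G ->
  (betti_number F i j <= betti_number G i j)%N.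
Proof.
move=> FS GS; have [phi [psi [h [t [[hphi hpsi] _ _ phipsi [_ t0]]]]]] := comparison i FS GS.
have [_ _ mnF] := FS.
have deg0 r s (dr : 'I_r -> nat) (ds : 'I_s -> nat) (M : 'M[R]_(r, s)) a b :
    homog_mx dr ds M -> dr a != ds b -> (M a b)@_0%MM = 0.
  move=> hM ab; apply/eqP/negPn/negP; rewrite -mcoeff_msupp => /hM; rewrite mdeg0 => ba.
  by rewrite -ba eqxx in ab.
pose A := [set a : 'I_(rk F i) | deg a == j]; pose B := [set b : 'I_(rk G i) | deg b == j].
pose mA := \matrix_(a < #|A|, b < #|B|) (phi (enum_val a) (enum_val b))@_0%MM.
pose mB := \matrix_(b < #|B|, a < #|A|) (psi (enum_val b) (enum_val a))@_0%MM.
apply: (@mulmx1_min _ _ _ mA mB); apply/matrixP => a a'; rewrite !mxE.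
under eq_bigr do rewrite !mxE.
rewrite -(big_enum_val (fun b => (phi (enum_val a) b)@_0%MM * (psi b (enum_val a'))@_0%MM)) /=.
have -> : \sum_(b in B) (phi (enum_val a) b)@_0%MM * (psi b (enum_val a'))@_0%MM
    = ((phi *m psi) (enum_val a) (enum_val a'))@_0%MM.
  rewrite mxE raddf_sum /= big_mkcond; apply: eq_bigr => b _; rewrite rmorphM /=.
  case: ifP => // bB; rewrite (deg0 _ _ _ _ _ _ _ hphi) ?mul0r //.
  have := enum_valP a; rewrite !inE => /eqP->; rewrite eq_sym.
  by move: bB; rewrite inE => ->.
rewrite phipsi !mxE !mcoeffD t0 addr0 raddf_sum big1 ?addr0 => [|c _].
  by rewrite (inj_eq enum_val_inj); case: eqP => _; rewrite ?mcoeff1 ?eqxx ?mcoeff0.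
by rewrite /= rmorphM /= mnF mulr0.
Qed.

Lemma betti_number_unique (F G : free_complex K X) i j :
  minimal_free_resolution S F -> minimal_free_resolution S G ->
  betti_number F i j = betti_number G i j.
Proof. by move=> FS GS; apply/eqP; rewrite eqn_leq !betti_number_le. Qed.

End Augmentation.
End Uniqueness.

(** * Euler characteristics and face numbers *)

Section Euler.
Variables (K : fieldType) (X : finType).
Implicit Types (S : {set {set X}}) (A B C U : {set X}).

Lemma rank_strand_mx r (W : 'I_r -> {set X}) U :
  \rank (strand_mx K W U) = #|[set a | W a \subset U]|.
Proof.
set A := [set a | W a \subset U].
pose E : 'M[K]_(#|A|, r) := \matrix_(k, a) (enum_val k == a)%:R.
have /eqmx_rank -> : (strand_mx K W U == E)%MS.
  apply/andP; split; apply/row_subP => i; last first.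
    apply/sub_strand_mx => a; rewrite !mxE; case: (_ =P a) => [<- _|]; last by rewrite eqxx.
    by have := enum_valP i; rewrite inE.
  have [iA|iA] := boolP (i \in A).
    have -> : row i (strand_mx K W U) = row (enum_rank_in iA i) E.
      apply/rowP=> a; rewrite !mxE enum_rankK_in //.
      by move: iA; rewrite inE => ->; rewrite mulrb; case: (i == a).
    exact: row_sub.
  suff -> : row i (strand_mx K W U) = 0 by exact: sub0mx.
  apply/rowP=> a; rewrite !mxE; move: iA; rewrite inE => /negbTE->.
  by rewrite mul0rn.
apply/eqP; rewrite -/(row_free E); apply/row_freeP; exists E^T.
apply/matrixP=> k l; rewrite !mxE (bigD1 (enum_val k)) //= !mxE eqxx mul1r.
rewrite big1 ?addr0 => [|a ak]; first by rewrite eq_sym (inj_eq enum_val_inj).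
by rewrite !mxE eq_sym (negbTE ak) mul0r.
Qed.

Section Resolution.
Variables (S : {set {set X}}) (D : squarefree_complex K X).
Hypothesis Dres : squarefree_resolution S D.

Definition strand_rk i U := #|[set a : 'I_(srk D i) | lab a \subset U]|.

Definition syz_rk i U := \rank (strand_mx K (@lab K X D i.+1) U *m smx D i).

Lemma sub_syz_mx i U (v : 'rV_(srk D i)) :
  (v <= strand_mx K (@lab K X D i.+1) U *m smx D i)%MS <-> @syzygies K X S D i U v.
Proof.
case: Dres => _ _ ex _; rewrite ex; split=> [/submxP[u ->]|[w /sub_strand_mx sw ->]].
  by exists (u *m strand_mx K (@lab K X D i.+1) U); rewrite ?mulmxA //; apply/sub_strand_mx/submxMl.
exact: submxMr.
Qed.

(** Rank and nullity of the differential on the strand. *)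
Lemma strand_rkS i U : strand_rk i.+1 U = (syz_rk i U + syz_rk i.+1 U)%N.
Proof.
rewrite /strand_rk -rank_strand_mx -(mxrank_mul_ker _ (smx D i)); congr (_ + _)%N.
apply/eqmx_rank/andP; split; apply/rV_subP => v.
  rewrite sub_capmx => /andP[/sub_strand_mx sv /sub_kermxP v0]; exact/sub_syz_mx.
move/sub_syz_mx => [sv v0]; rewrite sub_capmx; apply/andP; split; last exact/sub_kermxP.
exact/sub_strand_mx.
Qed.

Lemma strand_rk0 U : strand_rk 0 U = 1%N.
Proof.
case: Dres => r0 lab0 _ _; rewrite /strand_rk (_ : [set a | _] = setT) ?cardsT ?card_ord //.
by apply/setP=> a; rewrite !inE lab0 sub0set.
Qed.

Lemma syz_rk0 U : syz_rk 0 U = (U \notin S).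
Proof.
case: (Dres) => r0 _ _ _; have [US|US] := boolP (U \in S) => /=.
  apply/eqP; rewrite mxrank_eq0 -submx0; apply/rV_subP => v /sub_syz_mx/= v0.
  by rewrite v0 ?sub0mx.
have /eqmx_rank : (strand_mx K (@lab K X D 1) U *m smx D 0 == 1%:M)%MS.
  rewrite submx1 /=; apply/rV_subP => v _; apply/sub_syz_mx => /= US'.
  by rewrite US' in US.
by rewrite /syz_rk => ->; rewrite mxrank1.
Qed.

Lemma smx_row_neq0 i (b : 'I_(srk D i.+1)) : exists a, smx D i b a != 0.
Proof.
have [/existsP//|] := boolP [exists a, smx D i b a != 0].
rewrite negb_exists => /forallP b0.
have Zb : @syzygies K X S D i.+1 (lab b) (delta_mx 0 b).
  split; first exact: in_strand_delta.
  by rewrite -rowE; apply/rowP => a; rewrite !mxE; apply/eqP/negPn/b0.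
have /(_ b) := syzygies_proper Dres Zb.
by rewrite mxE !eqxx properxx oner_eq0 => /(_ isT).
Qed.

(** Labels grow strictly along the differential and no row of it vanishes, so the
    resolution stops after [#|X|] steps. *)
Lemma leq_card_lab i (a : 'I_(srk D i)) : (i <= #|lab a|)%N.
Proof.
elim: i a => // i IH b; have [a /(lab_proper Dres)/proper_card] := smx_row_neq0 b.
exact: leq_ltn_trans (IH a).
Qed.

Lemma syz_rk_eq0 i U : (#|U| <= i)%N -> syz_rk i U = 0%N.
Proof.
move=> Ui; apply/eqP; rewrite mxrank_eq0 -submx0; apply/rV_subP => v /sub_syz_mx Zv.
rewrite submx0; apply/eqP/rowP => a; rewrite mxE; apply/eqP/negPn/negP => va.
have := proper_card (syzygies_proper Dres Zv va).
by rewrite ltnNge (leq_trans Ui (leq_card_lab a)).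
Qed.

(** The alternating sum of the strand dimensions telescopes, since each of them is
    the sum of two consecutive ranks. *)
Lemma strand_euler U n : (#|U| <= n)%N ->
  \sum_(i < n.+1) (-1) ^+ i * (strand_rk i U)%:R = (U \in S)%:R :> int.
Proof.
have H k : \sum_(i < k.+1) (-1) ^+ i * (strand_rk i U)%:R
    = (U \in S)%:R + (-1) ^+ k * (syz_rk k U)%:R :> int.
  elim: k => [|k IH].
    by rewrite big_ord1 strand_rk0 syz_rk0 expr0 !mul1r; case: (U \in S).
  rewrite big_ord_recr /= IH strand_rkS natrD exprS !mulN1r !mulNr mulrDr.
  by rewrite opprD addrA addrK.
by move=> Un; rewrite H (syz_rk_eq0 Un) mulr0 addr0.
Qed.

(** These are the graded Betti numbers of the realization. *)
Definition sbetti i j := #|[set a : 'I_(srk D i) | #|lab a| == j]|.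

Definition face_number u := #|[set F in S | #|F| == u]|.

Lemma card_supersets A u :
  #|[set U : {set X} | A \subset U & #|U| == u]| =
  if (#|A| <= u)%N then 'C(#|X| - #|A|, u - #|A|) else 0%N.
Proof.
case: leqP => [Au|uA]; last first.
  apply/eqP; rewrite cards_eq0; apply/eqP/setP=> U; rewrite !inE; apply/negP.
  by case/andP=> /subset_leq_card + /eqP Uu; rewrite Uu leqNgt uA.
have <- : #|~: A| = (#|X| - #|A|)%N by rewrite -(cardsC A) addKn.
rewrite -cards_draws -[RHS](card_in_imset (f := fun B => B :|: A)) => [|B C].
  congr #|pred_of_set _|; apply/setP => U; apply/idP/imsetP => [|[B]].
    rewrite inE => /andP[AU /eqP Uu]; exists (U :\: A).
      by rewrite inE setDE subsetIr -setDE cardsD (setIidPr AU) Uu /=.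
    by rewrite setUC -{1}(setIidPr AU) setID.
  rewrite !inE => /andP[BA /eqP Bu] ->; rewrite subsetUr cardsU.
  have -> : B :&: A = set0 by apply/eqP; rewrite setI_eq0 disjoints_subset.
  by rewrite cards0 subn0 Bu subnK /=.
rewrite !inE => /andP[BA _] /andP[CA _] BC.
have UK B' : B' \subset ~: A -> (B' :|: A) :\: A = B'.
  by rewrite -disjoints_subset => BA'; rewrite setDUl setDv setU0; apply/setDidPl.
by rewrite -(UK B BA) BC UK.
Qed.

(** Count the pairs of a basis element and a set of size [u] above its label. *)
Lemma sum_strand_rk i u :
  \sum_(U : {set X} | #|U| == u) strand_rk i U
   = (\sum_(j < u.+1) sbetti i j * 'C(#|X| - j, u - j))%N.
Proof.
transitivity (\sum_(a : 'I_(srk D i)) #|[set U : {set X} | lab a \subset U & #|U| == u]|)%N.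
  transitivity (\sum_(U : {set X} | #|U| == u) \sum_(a : 'I_(srk D i)) (lab a \subset U : nat))%N.
    apply: eq_bigr => U _; rewrite /strand_rk -sum1_card big_mkcond.
    by apply: eq_bigr => a _; rewrite inE; case: ifP.
  rewrite exchange_big; apply: eq_bigr => a _; rewrite -sum1_card big_mkcond [RHS]big_mkcond.
  by apply: eq_bigr => U _; rewrite inE; case: (lab a \subset U); case: (_ == u).
transitivity (\sum_(a : 'I_(srk D i)) \sum_(j < u.+1) (#|lab a| == j) * 'C(#|X| - j, u - j))%N.
  apply: eq_bigr => a _; rewrite card_supersets; case: leqP => au.
    rewrite (bigD1 (Ordinal (au : (#|lab a| < u.+1)%N))) //= eqxx mul1n big1 ?addn0 // => j ja.
    by rewrite (_ : (_ == _) = false) //; apply: contraNF ja => /eqP aj; apply/eqP/val_inj.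
  by rewrite big1 // => j _; rewrite gtn_eqF // (leq_trans (ltn_ord j)).
rewrite exchange_big; apply: eq_bigr => j _; rewrite -big_distrl /=; congr (_ * _)%N.
by rewrite /sbetti -sum1_card [RHS]big_mkcond; apply: eq_bigr => a _; rewrite inE; case: (_ == _).
Qed.

(** The coefficient of degree [j] of the K-polynomial. *)
Definition euler_betti j : int := \sum_(i < #|X|.+1) (-1) ^+ i * (sbetti i j)%:R.

Lemma face_number_euler u :
  (face_number u)%:R = \sum_(j < u.+1) euler_betti j * ('C(#|X| - j, u - j))%:R :> int.
Proof.
have -> : face_number u = (\sum_(U : {set X} | #|U| == u) (U \in S))%N.
  rewrite /face_number -sum1_card big_mkcond [RHS]big_mkcond; apply: eq_bigr => U _.
  by rewrite inE andbC; case: (_ == u); case: (U \in S).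
rewrite natr_sum.
under eq_bigr => U _ do rewrite -(strand_euler (max_card (mem U))).
rewrite exchange_big /=.
transitivity (\sum_(i < #|X|.+1) \sum_(j < u.+1)
    ((-1) ^+ i * (sbetti i j)%:R * ('C(#|X| - j, u - j))%:R) : int).
  apply: eq_bigr => i _; rewrite -mulr_sumr -natr_sum sum_strand_rk natr_sum mulr_sumr.
  by apply: eq_bigr => j _; rewrite natrM mulrA.
by rewrite exchange_big; apply: eq_bigr => j _; rewrite mulr_suml.
Qed.

End Resolution.
End Euler.

Section Determination.
Variables (K : fieldType) (X Y : finType).
Variables (S : {set {set X}}) (T : {set {set Y}}).
Variables (D : squarefree_complex K X) (E : squarefree_complex K Y).
Hypotheses (DS : squarefree_resolution S D) (ET : squarefree_resolution T E).
Hypothesis XY : #|X| = #|Y|.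

Lemma face_number_sbetti : sbetti D =2 sbetti E -> face_number S =1 face_number T.
Proof.
move=> DE u; apply/eqP; rewrite -(eqr_nat int) (face_number_euler DS) (face_number_euler ET).
apply/eqP; rewrite XY; apply: eq_bigr => j _; congr (_ * _).
by rewrite /euler_betti XY; apply: eq_bigr => i _; rewrite DE.
Qed.

(** The system of [face_number_euler] is unitriangular. *)
Lemma euler_betti_face_number : face_number S =1 face_number T ->
  euler_betti D =1 euler_betti E.
Proof.
move=> fST j; elim/ltn_ind: j => u IH.
have : (face_number S u)%:R = (face_number T u)%:R :> int by rewrite fST.
rewrite (face_number_euler DS) (face_number_euler ET) !big_ord_recr /= !subnn !bin0 !mulr1 XY.
by under eq_bigr => j _ do rewrite IH //; move/addrI.
Qed.

Lemma sbetti_eq0 i j : (#|X| < i)%N -> sbetti D i j = 0%N.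
Proof.
move=> Xi; apply/eqP; rewrite cards_eq0; apply/eqP/setP=> a; exfalso.
have := leq_trans Xi (leq_trans (leq_card_lab DS a) (max_card _)).
by rewrite ltnn.
Qed.

End Determination.

(** The K-polynomial is determined by the face numbers. In each degree [j] the
    strand [j = i + d] contributes one term to its coefficient, so that a single
    strand is determined by all the others. *)
Lemma sbetti_off_strand (K : fieldType) (X Y : finType) (S : {set {set X}}) (T : {set {set Y}})
    (D : squarefree_complex K X) (E : squarefree_complex K Y) d :
  squarefree_resolution S D -> squarefree_resolution T E -> #|X| = #|Y| ->
  face_number S =1 face_number T ->
  (forall i j, j != (i + d)%N -> sbetti D i j = sbetti E i j) ->
  sbetti D =2 sbetti E.
Proof.
move=> DS ET XY fST off i j; have [jE|] := eqVneq j (i + d)%N; last exact: off.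
have [iX|iX] := leqP i #|X|; last by rewrite (sbetti_eq0 DS) // (sbetti_eq0 ET) -?XY.
have := euler_betti_face_number DS ET XY fST j; rewrite /euler_betti XY in iX *.
rewrite (bigD1 (Ordinal (iX : (i < #|Y|.+1)%N))) //=.
rewrite [RHS](bigD1 (Ordinal (iX : (i < #|Y|.+1)%N))) //=.
rewrite [X in _ + X](eq_bigr (fun k : 'I_#|Y|.+1 => (-1) ^+ k * (sbetti E k j)%:R)).
  by move/addIr/(mulrI (unitrX _ (unitrN1 _)))/eqP; rewrite eqr_nat => /eqP.
move=> k ki; rewrite off // jE eqn_add2r eq_sym.
by apply: contraNneq ki => ki; apply/eqP/val_inj.
Qed.

(** * Betti numbers of skeletons *)

Section SkeletonBetti.
Variables (K : fieldType) (X : finType).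
Implicit Types (S : {set {set X}}) (B U : {set X}) (D : squarefree_complex K X).

Lemma cohom_basis_ext (V : lmodType K) (Z Z' : {set X} -> V -> Prop) U q (J : finType) :
  (forall B, B \subset U -> (#|B| == q) || (#|B|.+1 == q) -> forall v, Z B v <-> Z' B v) ->
  cohom_basis Z U q J -> cohom_basis Z' U q J.
Proof.
move=> ZZ [zs [zs_cyc zs_gen zs_free]].
have cochZ z : cochain Z U q z <-> cochain Z' U q z.
  by split=> H B BU cB; apply/ZZ/H; rewrite ?cB ?eqxx.
have cobZ z : coboundary Z U q z <-> coboundary Z' U q z.
  by split=> -[w wZ wE]; exists w => // B BU cB; apply/ZZ/wZ; rewrite ?cB ?eqxx ?orbT.
exists zs; split=> [j|z [zZ z_cyc]|c /cobZ/zs_free//].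
  by have [zZ z_cyc] := zs_cyc j; split=> //; apply/cochZ.
by have [|c /cobZ cE] := zs_gen z; [split=> //; apply/cochZ|exists c].
Qed.

(** The coefficients of the Stanley-Reisner ideal, as a family of subspaces of the
    line. *)
Definition ideal_coeff S B (v : 'rV[K]_1) : Prop := B \in S -> v = 0.

Lemma ideal_coeff_submod S : submod (ideal_coeff S).
Proof.
split=> [//|B u v Zu Zv BS|B c u Zu BS]; first by rewrite Zu ?Zv ?addr0.
by rewrite Zu ?scaler0.
Qed.

Lemma hochster_ideal S D i U : squarefree_resolution S D -> (i <= #|U|)%N ->
  cohom_basis (ideal_coeff S) U (#|U| - i) {b : 'I_(srk D i.+1) | lab b == U}.
Proof.
move=> DS iU; have [r0 _ _ _] := DS.
have : cohom_basis (fun B (v : 'rV[K]_(srk D 0)) => B \in S -> v = 0) U (#|U| - i)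
    {b : 'I_(srk D i.+1) | lab b == U} := hochster DS iU.
by rewrite r0.
Qed.

(** The multigraded Betti number of degree [U]. *)
Definition lab_mult (D : squarefree_complex K X) i U := #|[set b : 'I_(srk D i) | lab b == U]|.

Lemma sbetti_mult D i j : sbetti D i j = (\sum_(U : {set X} | #|U| == j) lab_mult D i U)%N.
Proof.
rewrite /sbetti /lab_mult -sum1_card (partition_big (@lab K X D i) (fun U => #|U| == j)) /=.
  apply: eq_bigr => U /eqP Uj; rewrite -sum1_card; apply: eq_bigl => a.
  by rewrite !inE andbC; case: eqP => // ->; rewrite Uj eqxx.
by move=> a; rewrite inE.
Qed.

Lemma lab_mult_small S D i U : squarefree_resolution S D -> (#|U| < i)%N -> lab_mult D i U = 0%N.
Proof.
move=> DS Ui; apply/eqP; rewrite cards_eq0; apply/eqP/setP=> b; rewrite !inE; apply/eqP => bU.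
by have := leq_card_lab DS b; rewrite bU leqNgt Ui.
Qed.

(** Hochster's formula only looks at subsets of [U] of two consecutive sizes, because
    the cocycle condition does not see which sets are faces. *)
Lemma lab_mult_le S S' D D' i U : squarefree_resolution S D -> squarefree_resolution S' D' ->
  (i <= #|U|)%N ->
  (forall B, B \subset U -> (#|B| == #|U| - i)%N || (#|B|.+1 == #|U| - i)%N ->
     (B \in S) = (B \in S')) ->
  (lab_mult D i.+1 U <= lab_mult D' i.+1 U)%N.
Proof.
move=> DS DS' iU SS'.
have := hochster_ideal DS iU; have := hochster_ideal DS' iU.
have cardE (P : squarefree_complex K X) :
    #|{: {b : 'I_(srk P i.+1) | lab b == U}}| = lab_mult P i.+1 U.
  by rewrite card_sig; apply: eq_card => b; rewrite !inE.
rewrite -!cardE => H' H; apply: (cohom_basis_le (ideal_coeff_submod S') _ H').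
by apply: cohom_basis_ext H => B BU cB v; rewrite /ideal_coeff SS'.
Qed.

Lemma lab_mult_eq S S' D D' i U : squarefree_resolution S D -> squarefree_resolution S' D' ->
  (i <= #|U|)%N ->
  (forall B, B \subset U -> (#|B| == #|U| - i)%N || (#|B|.+1 == #|U| - i)%N ->
     (B \in S) = (B \in S')) ->
  lab_mult D i.+1 U = lab_mult D' i.+1 U.
Proof.
move=> DS DS' iU SS'; apply/eqP.
rewrite eqn_leq (lab_mult_le DS DS' iU SS') (lab_mult_le DS' DS) //.
by move=> B BU cB; rewrite SS'.
Qed.

Lemma lab_mult_acyclic S D i U : squarefree_resolution S D -> (i <= #|U|)%N ->
  (forall z, cocycle (ideal_coeff S) U (#|U| - i) z -> coboundary (ideal_coeff S) U (#|U| - i) z) ->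
  lab_mult D i.+1 U = 0%N.
Proof.
move=> DS iU acyc; apply/eqP; rewrite -leqn0.
have -> : lab_mult D i.+1 U = #|{: {b : 'I_(srk D i.+1) | lab b == U}}|.
  by rewrite card_sig; apply: eq_card => b; rewrite !inE.
rewrite -(card_ord 0); apply: (cohom_basis_le (ideal_coeff_submod S) (hochster_ideal DS iU)).
exists (fun _ _ => 0); split=> [[]//|z /acyc zc|c _ []//].
exists (fun _ => 0); apply: eq_coboundary zc => B _ _.
by rewrite big_ord0 subr0.
Qed.

(** The skeleton of dimension [d - 1]. *)
Definition skel d S : {set {set X}} := [set F in S | (#|F| <= d)%N].

Lemma sbetti0 S D j : squarefree_resolution S D -> sbetti D 0 j = (j == 0%N).
Proof.
case=> r0 lab0 _ _; rewrite /sbetti; have [->|j0] := eqVneq j 0%N.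
  rewrite (_ : [set a | _] = setT) ?cardsT ?card_ord ?r0 //.
  by apply/setP=> a; rewrite !inE lab0 cards0.
by apply/eqP; rewrite cards_eq0; apply/eqP/setP=> a; rewrite !inE lab0 cards0 eq_sym (negbTE j0).
Qed.

(** For [j < i + d] the sets which enter Hochster's formula have at most [d]
    elements, and among these the skeleton has the same faces. *)
Lemma sbetti_skel_low S D D' d i j : squarefree_resolution S D ->
  squarefree_resolution (skel d S) D' -> (j < i + d)%N -> sbetti D' i j = sbetti D i j.
Proof.
move=> DS DS'; case: i => [|i] ji; first by rewrite (sbetti0 _ DS) (sbetti0 _ DS').
rewrite !sbetti_mult; apply: eq_bigr => U /eqP Uj.
have [iU|Ui] := leqP i #|U|; last by rewrite (lab_mult_small DS) ?(lab_mult_small DS') // ltnW.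
apply: (lab_mult_eq DS' DS iU) => B BU cB; rewrite inE.
suff -> : (#|B| <= d)%N by rewrite andbT.
have qd : (#|U| - i <= d)%N by rewrite leq_subLR Uj -ltnS.
by case/orP: cB => /eqP cB; [rewrite cB|apply: ltnW; rewrite cB].
Qed.

(** For [i + d < j] the sets which enter Hochster's formula have more than [d]
    elements, so that none is a face: what remains is the cohomology of a nonempty
    simplex. *)
Lemma sbetti_skel_high S D' d i j : squarefree_resolution (skel d S) D' ->
  (i + d < j)%N -> sbetti D' i j = 0%N.
Proof.
move=> DS'; case: i => [|i] ji.
  by rewrite (sbetti0 _ DS') gtn_eqF // (leq_trans _ ji).
rewrite sbetti_mult big1 // => U /eqP Uj.
have dU : (d.+1 < #|U| - i)%N by rewrite Uj ltn_subRL addnS.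
have iU : (i <= #|U|)%N by rewrite ltnW // -subn_gt0 (leq_trans _ dU).
apply: (lab_mult_acyclic DS' iU) => z [zZ z_cyc].
have triv B v : #|B| = (#|U| - i)%N \/ #|B|.+1 = (#|U| - i)%N -> ideal_coeff (skel d S) B v.
  move=> cB; rewrite /ideal_coeff inE => /andP[_ Bd]; exfalso; case: cB => cB.
    by move: dU; rewrite -cB ltnNge ltnW.
  by move: dU; rewrite -cB ltnS ltnNge Bd.
have [|B a BU cB _|w _ wE] := @in_strand_acyclic K X 1 (fun _ => set0) U (#|U| - i)%N z.
- by split=> // B _ _ a _; rewrite sub0set.
- by rewrite eq_sym -card_gt0 (leq_trans _ (leq_trans (ltnW dU) (leq_subr _ _))).
by exists w => // B BU cB; apply: triv; right.
Qed.

End SkeletonBetti.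

(** Only the strand [j = i + d] is not controlled by the Betti numbers of the whole
    complex, and there the face numbers decide. *)
Lemma sbetti_skel (K : fieldType) (X Y : finType) (S : {set {set X}}) (T : {set {set Y}})
    (D D' : squarefree_complex K X) (E E' : squarefree_complex K Y) d :
  squarefree_resolution S D -> squarefree_resolution T E ->
  squarefree_resolution (skel d S) D' -> squarefree_resolution (skel d T) E' ->
  #|X| = #|Y| -> sbetti D =2 sbetti E -> sbetti D' =2 sbetti E'.
Proof.
move=> DS ET DS' ET' XY DE; apply: (sbetti_off_strand DS' ET' XY (d := d)) => [u|i j ji].
  have skelE (Z : finType) (P : {set {set Z}}) :
      face_number (skel d P) u = if (u <= d)%N then face_number P u else 0%N.
    rewrite /face_number; case: leqP => ud.
      congr #|pred_of_set _|; apply/setP=> F; rewrite !inE.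
      by case: eqP => [->|]; rewrite ?andbF ?ud ?andbT.
    apply/eqP; rewrite cards_eq0; apply/eqP/setP=> F; rewrite !inE -andbA.
    by case: eqP => [->|]; rewrite ?andbF // leqNgt ud andbF.
  by rewrite !skelE (face_number_sbetti DS ET XY DE).
have [jid|] := ltnP j (i + d); first by rewrite (sbetti_skel_low DS DS') ?(sbetti_skel_low ET ET').
rewrite leq_eqVlt eq_sym (negbTE ji) /= => ijd.
by rewrite (sbetti_skel_high DS') ?(sbetti_skel_high ET').
Qed.

(** * Linear resolutions of complexes with a leaf order *)

(** A choice function for the branches of a leaf order. *)
Definition leaf_parents (X : finType) (s : seq {set X}) (par : nat -> nat) : Prop :=
  forall m, (0 < m < size s)%N -> (par m < m)%N /\
  forall i, (i < m)%N -> nth set0 s m :&: nth set0 s i \subset nth set0 s m :&: nth set0 s (par m).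

Section Froberg.
Variables (K : fieldType) (X : finType).
Implicit Types (S : {set {set X}}) (A B C F U : {set X}).

(** Vanishing of the cohomology of the complex [S] induced on [U], on faces with [q]
    elements. *)
Definition acyclic (V : lmodType K) S U q := forall z : {set X} -> V,
  (forall B, B \subset U -> B \in S -> #|B| = q.+1 -> cobd z B = 0) ->
  exists y, forall B, B \subset U -> B \in S -> #|B| = q -> z B = cobd y B.

Lemma acyclic_simplex (V : lmodType K) F U q : acyclic V (powerset F) U q.+1.
Proof.
move=> z z_cyc; have [UF0|[x xUF]] := set_0Vmem (U :&: F).
  exists z => B BU; rewrite powersetE => BF cB.
  have : B \subset U :&: F by rewrite subsetI BU.
  by rewrite UF0 subset0 => /eqP B0; rewrite B0 cards0 in cB.
exists (cone x z) => B BU; rewrite powersetE => BF cB.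
apply: (cobd_cone (U := U :&: F)) cB _ => //; first by rewrite subsetI BU.
by move=> C; rewrite subsetI => /andP[CU CF]; apply: z_cyc; rewrite ?powersetE.
Qed.

(** Mayer-Vietoris: local primitives differ on the intersection by a coboundary,
    which corrects one of them. *)
Lemma acyclicU (V : lmodType K) S1 S2 U q : down_closed S1 -> down_closed S2 ->
  acyclic V S1 U q.+1 -> acyclic V S2 U q.+1 -> acyclic V (S1 :&: S2) U q ->
  acyclic V (S1 :|: S2) U q.+1.
Proof.
move=> S1d S2d ac1 ac2 ac12 z z_cyc.
have [|y1 y1E] := ac1 z; first by move=> B BU BS; apply: z_cyc; rewrite // inE BS.
have [|y2 y2E] := ac2 z; first by move=> B BU BS; apply: z_cyc; rewrite // inE BS orbT.
have [|t tE] := ac12 (fun B => y1 B - y2 B).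
  move=> B BU; rewrite inE => /andP[B1 B2] cB.
  by rewrite cobdD cobdN -y1E // -y2E // subrr.
exists (fun B => if B \in S1 then y1 B else y2 B + cobd t B) => B BU BS cB.
have [B1|B1] := boolP (B \in S1).
  rewrite y1E //; apply: eq_cobd => x xB.
  by rewrite (S1d _ _ B1) // subsetDl.
have B2 : B \in S2 by move: BS; rewrite inE (negbTE B1).
transitivity (cobd (fun C => y2 C + cobd t C) B); first by rewrite cobdD cobd_cobd addr0 y2E.
apply: eq_cobd => x xB; case: ifP => // C1.
rewrite -(tE (B :\ x)) /=; first by rewrite addrC subrK.
- exact: subset_trans (subsetDl _ _) BU.
- by rewrite inE C1 (S2d _ _ B2) // subsetDl.
by apply: succn_inj; rewrite -cB (cardsD1 x B) xB.
Qed.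

(** The long exact sequence of the pair of the full simplex on [U] and the complex:
    a primitive on the simplex restricts to a cocycle on the faces, and subtracting
    a primitive of the latter makes it vanish there. *)
Lemma ideal_acyclic S U q (z : {set X} -> 'rV[K]_1) :
  down_closed S -> U != set0 -> acyclic 'rV[K]_1 S U q ->
  cocycle (ideal_coeff S) U q.+1 z -> coboundary (ideal_coeff S) U q.+1 z.
Proof.
move=> Sd /set0Pn[x xU] ac [zZ z_cyc].
have wE B : B \subset U -> #|B| = q.+1 -> z B = cobd (cone x z) B.
  by move=> BU cB; apply: (cobd_cone xU BU cB).
have [|t tE] := ac (cone x z).
  by move=> B BU BS cB; rewrite -wE // zZ.
exists (fun B => if B \in S then 0 else cone x z B - cobd t B) => B BU cB.
  by move=> BS; rewrite BS.
transitivity (cobd (fun C => cone x z C - cobd t C) B).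
  by rewrite cobdD cobdN cobd_cobd subr0 wE.
apply: eq_cobd => y yB; case: ifP => // CS.
rewrite -(tE (B :\ y)) ?subrr //; first exact: subset_trans (subsetDl _ _) BU.
by apply: succn_inj; rewrite -cB (cardsD1 y B) yB.
Qed.

Section LeafOrder.
Variables (S : {set {set X}}) (s : seq {set X}) (par : nat -> nat).
Hypothesis S_down : down_closed S.
Hypothesis s_facets : perm_eq s (enum (facets S)).
Hypothesis parP : leaf_parents s par.

Lemma mem_facets A : A \in s = (A \in facets S).
Proof. by rewrite (perm_mem s_facets) mem_enum. Qed.

Lemma mem_complex B : B \in S = has (fun A => B \subset A) s.
Proof.
apply/idP/hasP => [/maxset_exists[A Amax BA]|[A]].
  by exists A; rewrite // mem_facets inE.
by rewrite mem_facets inE => /maxsetp AS; apply: S_down.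
Qed.

Definition prefix_complex m : {set {set X}} :=
  [set B : {set X} | has (fun A => B \subset A) (take m s)].

Lemma prefix_down m : down_closed (prefix_complex m).
Proof.
move=> U B; rewrite !inE => /hasP[A As UA] BU; apply/hasP; exists A => //.
exact: subset_trans BU UA.
Qed.

Lemma has_prefix m B : (m <= size s)%N ->
  reflect (exists2 i, (i < m)%N & B \subset nth set0 s i) (B \in prefix_complex m).
Proof.
move=> ms; rewrite inE; apply: (iffP (has_nthP set0)) => -[i im Bi]; exists i.
- by move: im; rewrite size_takel.
- by move: Bi; rewrite nth_take //; move: im; rewrite size_takel.
- by rewrite size_takel.
- by rewrite nth_take.
Qed.

Lemma prefixS m : (m < size s)%N ->
  prefix_complex m.+1 = prefix_complex m :|: powerset (nth set0 s m).
Proof.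
move=> ms; apply/setP=> B; rewrite !inE (take_nth set0 ms) -cats1 has_cat /=.
by rewrite orbF.
Qed.

Lemma prefix_facet m : (0 < m < size s)%N ->
  prefix_complex m :&: powerset (nth set0 s m) = powerset (nth set0 s m :&: nth set0 s (par m)).
Proof.
move=> m0s; have /andP[m0 ms] := m0s; have [pm sub] := parP m0s.
apply/setP=> B; rewrite inE !powersetE; apply/andP/idP => [[/has_prefix[|i im Bi Bm]]|].
- exact: ltnW.
- by apply: subset_trans (sub i im); rewrite subsetI Bm.
rewrite subsetI => /andP[Bm Bp]; split=> //.
by apply/has_prefix; [exact: ltnW|exists (par m)].
Qed.

Lemma powerset_down F : down_closed (powerset F).
Proof. by move=> U B; rewrite !powersetE => UF BU; apply: subset_trans BU UF. Qed.

(** Adding the facets in a leaf order glues a simplex along a simplex each time. *)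
Lemma leaf_acyclic (V : lmodType K) U q : acyclic V S U q.+2.
Proof.
have -> : S = prefix_complex (size s).
  by apply/setP=> B; rewrite mem_complex inE take_size.
have : (size s <= size s)%N by [].
elim: {1 3}(size s) => [|m IH] ms.
  by move=> z _; exists z => B _; rewrite inE take0.
rewrite prefixS //; case: m IH ms => [|m] IH ms.
  rewrite (_ : prefix_complex 0 = set0) ?set0U; last by apply/setP=> B; rewrite !inE take0.
  exact: acyclic_simplex.
apply: acyclicU.
- exact: prefix_down.
- exact: powerset_down.
- exact/IH/ltnW.
- exact: acyclic_simplex.
by rewrite prefix_facet //; apply: acyclic_simplex.
Qed.

(** With a leaf order the cohomology lives in the lowest two sizes, so that the ideal
    has a linear resolution, as in Froberg's theorem. *)
Lemma linear_strand_high (D : squarefree_complex K X) i j : squarefree_resolution S D ->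
  (0 < i)%N -> (i.+1 < j)%N -> sbetti D i j = 0%N.
Proof.
move=> DS; case: i => // i _ ij; rewrite sbetti_mult big1 // => U /eqP Uj.
have iU : (i <= #|U|)%N by rewrite Uj ltnW // ltnW // ltnW.
apply: (lab_mult_acyclic DS iU) => z.
have [q ->] : exists q, (#|U| - i)%N = q.+3.
  have : (3 <= #|U| - i)%N by rewrite leq_subRL // Uj addnC.
  by case: (#|U| - i)%N => [|[|[|q]]] // _; exists q.
apply: ideal_acyclic => //; last exact: leaf_acyclic.
by rewrite -card_gt0 Uj (leq_trans _ ij).
Qed.

End LeafOrder.

(** The minimal nonfaces have at least two elements, and labels grow strictly. *)
Lemma linear_strand_low S (D : squarefree_complex K X) i (b : 'I_(srk D i.+1)) :
  squarefree_resolution S D -> set0 \in S -> (forall x, [set x] \in S) -> (i.+2 <= #|lab b|)%N.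
Proof.
move=> DS S0 S1; elim: i b => [|i IH] b; last first.
  have [a /(lab_proper DS)/proper_card] := smx_row_neq0 DS b.
  exact: (leq_ltn_trans (IH a)).
have [a Cba] := smx_row_neq0 DS b; rewrite ltnNge; apply/negP => b1.
have bS : lab b \in S.
  case: (posnP #|lab b|) => [/eqP|b0]; first by rewrite cards_eq0 => /eqP->.
  by have /cards1P[x ->] : #|lab b| == 1%N by rewrite eqn_leq b1.
have /= := syzygies_gen DS (in_strand_delta (@lab K X D 1) b); rewrite -rowE => /(_ bS)/rowP/(_ a).
by rewrite !mxE => Cba0; rewrite Cba0 eqxx in Cba.
Qed.

End Froberg.

(** * The resolution of the Alexander dual *)

Section DualResolution.
Variables (K : fieldType) (X : finType).
Implicit Types (A B C F U : {set X}).
Variables (S : {set {set X}}) (s : seq {set X}) (par : nat -> nat).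
Hypothesis S_down : down_closed S.
Hypothesis s_facets : perm_eq s (enum (facets S)).
Hypothesis parP : leaf_parents s par.
Hypothesis s_ge2 : (2 <= size s)%N.

Local Notation "s_[ i ]" := (nth set0 s i) (format "s_[ i ]").

Definition separator m := s_[m] :&: s_[par m].

(** The nonfaces of the dual are the sets containing the complement of a facet. The
    generators of the ideal are therefore the complements of the facets; the leaf
    order arranges the facets in a tree, and each edge of this tree, from a facet
    to its parent, gives one syzygy, of degree the complement of the separator. *)
Definition dual_rk i := match i with 0 => 1 | 1 => size s | 2 => (size s).-1 | _ => 0 end.

Definition dual_lab i : 'I_(dual_rk i) -> {set X} :=
  match i return 'I_(dual_rk i) -> {set X} with
  | 1 => fun a => ~: s_[a]
  | 2 => fun k => ~: separator k.+1
  | _ => fun _ => set0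
  end.

Definition dual_mx i : 'M[K]_(dual_rk i.+1, dual_rk i) :=
  match i return 'M[K]_(dual_rk i.+1, dual_rk i) with
  | 0 => const_mx 1
  | 1 => \matrix_(k, a) ((a == k.+1 :> nat)%:R - (a == par k.+1 :> nat)%:R)
  | _ => 0
  end.

Definition dual_complex := @SquarefreeComplex K X dual_rk dual_lab dual_mx.

Lemma nth_facet a : (a < size s)%N -> maxset (fun A => A \in S) s_[a].
Proof. by move=> sa; have := mem_nth set0 sa; rewrite (mem_facets s_facets) inE. Qed.

Lemma nth_sub a b : (a < size s)%N -> (b < size s)%N -> s_[a] \subset s_[b] -> a = b.
Proof.
move=> sa sb ab; have /maxsetp bS := nth_facet sb.
have := maxsetsup (nth_facet sa) bS ab => /eqP; rewrite nth_uniq // => [/eqP//|].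
by rewrite (perm_uniq s_facets) enum_uniq.
Qed.

Lemma size_pred k : (k < (size s).-1)%N -> (0 < k.+1 < size s)%N.
Proof. by move=> ks; rewrite /= -ltn_predRL. Qed.

(** This is minimality: a separator is a proper subset of both facets, since no
    facet contains another. *)
Lemma dual_mx_lab (k : 'I_(size s).-1) (a : 'I_(size s)) :
  dual_mx 1 k a != 0 -> separator k.+1 \proper s_[a].
Proof.
have ks := size_pred (ltn_ord k); have [pk sub] := parP ks; have /andP[_ kk] := ks.
have kp : s_[k.+1] :&: s_[par k.+1] \proper s_[k.+1].
  rewrite properE subsetIl subsetI subxx /=; apply/negP => /(nth_sub kk (ltn_trans pk kk)) E.
  by rewrite -E ltnn in pk.
have pp : s_[k.+1] :&: s_[par k.+1] \proper s_[par k.+1].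
  rewrite properE subsetIr subsetI subxx andbT /=; apply/negP => /(nth_sub (ltn_trans pk kk) kk) E.
  by rewrite E ltnn in pk.
rewrite mxE; case: (_ =P k.+1) => [-> //|_]; case: (_ =P par k.+1) => [-> //|_].
by rewrite subrr eqxx.
Qed.

Lemma facet_neqT a : (a < size s)%N -> s_[a] != setT.
Proof.
move=> sa; apply/eqP => aT; have sub b : s_[b] \subset s_[a] by rewrite aT subsetT.
have s0 := ltn_trans (ltn0Sn 0) s_ge2.
by have := nth_sub s_ge2 sa (sub 1%N); have := nth_sub s0 sa (sub 0%N) => <-.
Qed.

Lemma dual_row_sum (k : 'I_(size s).-1) : \sum_(a < size s) dual_mx 1 k a = 0.
Proof.
have ks := size_pred (ltn_ord k); have [pk _] := parP ks; have /andP[_ kk] := ks.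
have one i : (i < size s)%N -> \sum_(a < size s) ((a == i :> nat)%:R : K) = 1.
  move=> is_; rewrite (bigD1 (Ordinal is_)) //= eqxx big1 ?addr0 // => a ai.
  by rewrite (_ : (a == i :> nat) = false) //; apply: contraNF ai => /eqP ai; apply/eqP/val_inj.
under eq_bigr do rewrite mxE.
by rewrite sumrB !one ?subrr // (ltn_trans pk).
Qed.

(** The facets containing a given face form a subtree: if the last of them is not
    the only one, then its parent contains the face as well, by the leaf condition.
    A vector of sum zero on the vertices of the subtree is thus reduced to zero by
    subtracting edges from the last vertex on. *)
Lemma dual_span n U (v : 'rV[K]_(size s)) : (forall a, v 0 a != 0 -> (a < n)%N) ->
  in_strand (dual_lab (i := 1)) U v -> \sum_a v 0 a = 0 ->
  exists2 w, in_strand (dual_lab (i := 2)) U w & v = w *m dual_mx 1.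
Proof.
elim: n v => [|n IH] v vn sv v0.
  exists 0 => [a|]; first by rewrite mxE eqxx.
  by rewrite mul0mx; apply/rowP=> a; rewrite mxE; apply/eqP/negPn/negP => /vn.
have [|] := boolP [exists a : 'I_(size s), (a == n :> nat) && (v 0 a != 0)]; last first.
  rewrite negb_exists => /forallP nv; apply: IH => // a va.
  have := vn a va; rewrite ltnS leq_eqVlt => /predU1P[an|//].
  by have := nv a; rewrite an eqxx va.
case/existsP=> a /andP[/eqP an va].
have [i ia vi] : exists2 i, i != a & v 0 i != 0.
  apply/exists_inP; apply: contraNT va => /exists_inPn vi.
  by move: v0; rewrite (bigD1 a) //= big1 ?addr0 => [->//|i /vi/negPn/eqP].
have ltia : (i < a)%N.
  by have := vn i vi; rewrite an ltnS leq_eqVlt (_ : (i == n :> nat) = false) // -an; apply: negbTE.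
have as_ : (0 < a < size s)%N by rewrite (leq_ltn_trans _ ltia) /=.
have [pa sub] := parP as_.
have ks : (a.-1 < (size s).-1)%N by rewrite ltn_predRL prednK ?(leq_ltn_trans _ ltia).
pose k : 'I_(size s).-1 := Ordinal ks.
have kE : k.+1 = a by rewrite /= prednK // (leq_ltn_trans _ ltia).
have UF : ~: U \subset separator k.+1.
  rewrite kE; apply: subset_trans (sub i ltia); rewrite subsetI.
  by rewrite -!(subCset _ U) (sv a va) (sv i vi).
have kU : dual_lab (i := 2) k \subset U by rewrite subCset.
(* The edge from [a] to its parent, whose index is the predecessor of [a]. *)
pose v' := v - v 0 a *: row k (dual_mx 1).
have v'E b : v' 0 b = v 0 b - v 0 a * ((b == a)%:R - (b == par a :> nat)%:R).
  by rewrite !mxE kE -(inj_eq val_inj).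
have [|||w sw wE] := IH v'.
- move=> b; rewrite v'E; have [->|ba] := eqVneq b a.
    by rewrite gtn_eqF // subr0 mulr1 subrr eqxx.
  have [bp _|_] := eqVneq (b : nat) (par a); first by rewrite bp -an.
  rewrite subrr mulr0 subr0 => /vn; rewrite ltnS leq_eqVlt => /predU1P[bn|//].
  by case/eqP: ba; apply: ord_inj; rewrite bn an.
- move=> b; rewrite v'E; have [bp _|_] := eqVneq (b : nat) (par a).
    rewrite /= bp subCset; apply: subset_trans UF _.
    by rewrite kE subsetIr.
  have [->|_] := eqVneq b a; first by move=> _; apply: sv.
  by rewrite subrr mulr0 subr0; apply: sv.
- under eq_bigr do rewrite !mxE.
  rewrite sumrB v0 sub0r -mulr_sumr (eq_bigr (fun b => dual_mx 1 k b)).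
    by rewrite dual_row_sum mulr0 oppr0.
  by move=> b _; rewrite [RHS]mxE.
exists (w + v 0 a *: delta_mx 0 k); last first.
  by rewrite mulmxDl -wE -scalemxAl -rowE subrK.
have [_ sD sZ] := in_strand_submod K (dual_lab (i := 2)).
apply: sD => // b; rewrite !mxE eqxx /=; case: (b =P k) => [->//|_].
by rewrite mulr0 eqxx.
Qed.

(** A combination of edges is determined from the last vertex on: the edge from a
    vertex to its parent is the last to meet that vertex. *)
Lemma dual_inj (w : 'rV[K]_(size s).-1) : w *m dual_mx 1 = 0 -> w = 0.
Proof.
move=> w0; apply/rowP=> k; rewrite mxE; apply/eqP/negPn/negP => wk.
have [l wl lmax] := @arg_maxnP _ k (fun k => w 0 k != 0) (fun k => val k) wk.
have ls := size_pred (ltn_ord l); have [pl _] := parP ls; have /andP[_ ll] := ls.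
have /rowP/(_ (Ordinal ll)) := w0; rewrite !mxE (bigD1 l) //= big1 => [|j jl].
  by rewrite !mxE /= eqxx gtn_eqF // subr0 mulr1 addr0 => wl0; rewrite wl0 eqxx in wl.
have [->|wj] := eqVneq (w 0 j) 0; first by rewrite mul0r.
have jltl : (j < l)%N.
  have : (j <= l)%N := lmax j wj.
  by rewrite leq_eqVlt => /orP[/eqP/val_inj jE|//]; rewrite jE eqxx in jl.
have [pj _] := parP (size_pred (ltn_ord j)).
rewrite mxE /= eqSS (gtn_eqF jltl) gtn_eqF ?subrr ?mulr0 //.
by apply: ltn_trans pj _; rewrite ltnS.
Qed.

Lemma dual_resolution : squarefree_resolution (alexander_dual S) dual_complex.
Proof.
split=> // [i U v|i b a].
  case: i v => [|[|[|i]]] v /=.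
  - split=> [v0|[w sw ->]].
      have [US|] := boolP (U \in alexander_dual S).
        by exists 0; [move=> a; rewrite mxE eqxx|rewrite (v0 US) mul0mx].
      rewrite inE negbK (mem_complex S_down s_facets) => /(has_nthP set0)[a sa Ua].
      exists (v 0 0 *: delta_mx 0 (Ordinal sa)) => [b|].
        rewrite !mxE eqxx /=; case: (b =P Ordinal sa) => [-> _|_]; last by rewrite mulr0 eqxx.
        by rewrite /= -(setCK U) setCS.
      by apply/rowP=> j; rewrite (ord1 j) -scalemxAl -rowE !mxE mulr1.
    rewrite inE (mem_complex S_down s_facets) => /hasPn Us.
    apply/rowP=> j; rewrite !mxE big1 // => a _; rewrite !mxE mulr1.
    apply/eqP/negPn/negP => /sw /=; apply/negP.
    by have := Us s_[a] (mem_nth set0 (ltn_ord a)); rewrite -{1}(setCK s_[a]) setCS.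
  - split=> [[sv v0]|[w sw ->]].
      apply: (dual_span (n := size s)) => //.
      transitivity ((v *m const_mx 1 : 'cV_1) 0 0); last by rewrite v0 mxE.
      by rewrite mxE; apply: eq_bigr => a _; rewrite mxE mulr1.
    split; last first.
      apply/rowP=> j; rewrite -mulmxA !mxE big1 // => k _.
      rewrite [X in _ * X]mxE (eq_bigr (fun a => dual_mx 1 k a)) ?dual_row_sum ?mulr0 //.
      by move=> a _; rewrite [X in _ * X]mxE mulr1.
    rewrite mulmx_sum_row; apply: in_strand_sum => k _ a; rewrite mxE mulf_eq0 negb_or.
    case/andP=> /sw kU; rewrite mxE => /dual_mx_lab/proper_sub ka.
    by apply: subset_trans kU; rewrite setCS.
  - split=> [[sv /dual_inj->]|[w _ ->]]; first by exists 0; rewrite ?mulmx0 // => -[].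
    by rewrite mulmx0; split; [move=> k; rewrite mxE eqxx|rewrite mul0mx].
  - have no : 'I_0 -> False by case.
    split=> _; first by exists 0; [move=> a; case: (no a)|apply/rowP => a; case: (no a)].
    by split; [move=> a; case: (no a)|apply: mulmx0].
case: i b a => [|[|[|i]]] b a //=.
- by move=> _; apply: contraNneq (facet_neqT (ltn_ord b)) => E; rewrite -(setCK s_[b]) -E setC0.
- by move/dual_mx_lab; apply: contraTneq => /setC_inj->; rewrite properxx.
- by case: b.
- by case: b.
Qed.
End DualResolution.

(** * Comparison of two complexes *)

Section SameBetti.
Variables (K : fieldType) (X Y : finType) (S : {set {set X}}) (T : {set {set Y}}).
Variables (D : squarefree_complex K X) (E : squarefree_complex K Y).
Hypotheses (S_down : down_closed S) (T_down : down_closed T).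
Hypotheses (DS : squarefree_resolution S D) (ET : squarefree_resolution T E).

Lemma same_bettiP : same_betti K S T <-> sbetti D =2 sbetti E.
Proof.
have minD := realize_resolution S_down DS; have minE := realize_resolution T_down ET.
split=> [[beta [F FS bF] [G GT bG]] i j|DE].
  rewrite -[LHS]/(betti_number (realize D) i j) (betti_number_unique S_down i j minD FS) -bF bG.
  exact: (betti_number_unique T_down i j GT minE).
by exists (sbetti D); [exists (realize D)|exists (realize E)].
Qed.
End SameBetti.

(** Passing to complements turns the shift by [delta] into an equality of multisets of
    codimensions. *)
Lemma perm_eq_shift (a b : seq nat) (M N : nat) (delta : int) :
  all (fun n => (n <= M)%N) a -> all (fun n => (n <= N)%N) b -> delta = N%:Z - M%:Z ->
  perm_eq [seq n%:Z | n <- b] [seq n%:Z + delta | n <- a] =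
  perm_eq [seq (N - n)%N | n <- b] [seq (M - n)%N | n <- a].
Proof.
move=> /allP aM /allP bN ->; apply/idP/idP => [/(perm_map (fun z : int => `|N%:Z - z|%N))|
  /(perm_map (fun k : nat => N%:Z - k%:Z))]; rewrite -!map_comp.
  congr perm_eq; apply/eq_in_map => n n_in /=.
    by rewrite subzn ?bN.
  by rewrite opprD opprB addrCA [N%:Z + _]addrCA subrr addr0 addrC subzn ?aM.
congr perm_eq; apply/eq_in_map => n n_in /=.
  by rewrite -subzn ?bN // subKr.
by rewrite -subzn ?aM // opprB addrCA addrC addrAC.
Qed.

Section FaceNumbers.
Variable X : finType.
Implicit Types S : {set {set X}}.

Lemma dual_down S : down_closed S -> down_closed (alexander_dual S).
Proof. by move=> Sd U B; rewrite !inE => US BU; apply: contra US => /Sd; apply; rewrite setCS. Qed.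

(** Complementation maps the nonfaces of [S] onto the faces of the dual. *)
Lemma face_number_dual S u : (u <= #|X|)%N ->
  (face_number S u + face_number (alexander_dual S) (#|X| - u) = 'C(#|X|, u))%N.
Proof.
move=> uX; rewrite -card_draws -[RHS](cardsID S) /face_number; congr (_ + _)%N.
  by congr #|pred_of_set _|; apply/setP=> F; rewrite !inE andbC.
rewrite -(card_imset _ (@setC_inj X)); congr #|pred_of_set _|; apply/setP=> F.
apply/imsetP/idP => [[B] |].
  rewrite !inE => /andP[BS /eqP Bu] ->; rewrite BS /=.
  by apply/eqP/(@addnI #|B|); rewrite cardsC Bu subnK.
rewrite !inE => /andP[FS /eqP Fu]; exists (~: F); rewrite ?setCK // !inE setCK FS /=.
by apply/eqP/(@addnI #|F|); rewrite cardsC Fu subnKC.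
Qed.

Lemma face_number_big S u : (#|X| < u)%N -> face_number S u = 0%N.
Proof.
move=> Xu; apply/eqP; rewrite cards_eq0; apply/eqP/setP => F; rewrite !inE.
by apply/negP => /andP[_ /eqP Fu]; have := max_card (mem F); rewrite Fu leqNgt Xu.
Qed.

Lemma skeletonE S (k : int) : -1 <= k -> skeleton k S = skel (absz (k + 1)) S.
Proof.
move=> k1; apply/setP=> F; rewrite !inE lerBlDr -[in LHS](@gez0_abs (k + 1)) ?lez_nat //.
by rewrite -lerBlDr sub0r.
Qed.

Lemma skel_down d S : down_closed S -> down_closed (skel d S).
Proof.
move=> Sd U B; rewrite !inE => /andP[US Ud] BU; rewrite (Sd _ _ US BU) /=.
exact: leq_trans (subset_leq_card BU) Ud.
Qed.

Lemma skel0 d S : set0 \in S -> set0 \in skel d S.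
Proof. by rewrite !inE cards0 => ->. Qed.

End FaceNumbers.

Lemma eq_face_number_dual (X Y : finType) (S : {set {set X}}) (T : {set {set Y}}) :
  #|X| = #|Y| -> face_number (alexander_dual S) =1 face_number (alexander_dual T) ->
  face_number S =1 face_number T.
Proof.
move=> XY ST u; have [uX|Xu] := leqP u #|X|; last by rewrite !face_number_big // -XY.
apply/eqP; rewrite -(eqn_add2r (face_number (alexander_dual S) (#|X| - u)%N)); apply/eqP.
by rewrite face_number_dual // ST XY face_number_dual // -XY.
Qed.

Section CliqueComplex.
Variables (V : finType) (e : rel V).

Lemma clique_down : down_closed (clique_complex e).
Proof.
move=> U B; rewrite !inE => /forall_inP Uc /subsetP BU; apply/forall_inP => x /BU/Uc/forall_inP H.
by apply/forall_inP => y /BU/H.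
Qed.

Lemma clique1 x : [set x] \in clique_complex e.
Proof.
rewrite inE; apply/forall_inP => y /set1P->; apply/forall_inP => z /set1P->.
by rewrite eqxx.
Qed.

Lemma clique0 : set0 \in clique_complex e.
Proof. by rewrite inE; apply/forall_inP => x; rewrite inE. Qed.

End CliqueComplex.

Section LeafComplex.
Variables (K : fieldType) (X : finType) (S : {set {set X}}) (s : seq {set X}).
Hypothesis S_down : down_closed S.
Hypothesis S_facets : (2 <= #|facets S|)%N.
Hypothesis s_leaf : leaf_order S s.

Lemma size_leaf : (2 <= size s)%N.
Proof. by case: s_leaf => /perm_size-> _; rewrite -cardE. Qed.

Lemma leaf_parent : exists par : nat -> nat, leaf_parents s par.
Proof.
have [_ leaf] := s_leaf.
suff /fin_all_exists[f fP] : forall m : 'I_(size s), exists p, (0 < m)%N -> (p < m)%N /\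
    forall i, (i < m)%N -> nth set0 s m :&: nth set0 s i \subset nth set0 s m :&: nth set0 s p.
  exists (fun m => if insub m is Some k then f k else 0%N) => m /andP[m0 ms].
  by rewrite insubT; apply: (fP (Ordinal ms)).
move=> m; have [->|m0] := posnP m; first by exists 0%N.
by have [|p pm sub] := leaf m; [rewrite m0 ltn_ord|exists p].
Qed.

(** The intersection with the union of all earlier facets is already attained at
    the parent. *)
Lemma nth_separators par k : leaf_parents s par ->
  (k < (size s).-1)%N -> nth set0 (separators s) k = separator s par k.+1.
Proof.
move=> parP ks; have k1s : (0 < k.+1 < size s)%N := size_pred ks.
have [pk sub] := parP _ k1s; case/andP: k1s => _ k1s.
rewrite (nth_map 0%N) ?size_iota // nth_iota // add1n /separator.
rewrite (big_nth set0) big_mkord size_takel; last exact: ltnW.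
apply/eqP; rewrite eqEsubset; apply/andP; split; apply/subsetP => x.
  rewrite inE => /andP[/bigcupP[i _]]; rewrite nth_take ?ltn_ord // => xi xk.
  by apply: (subsetP (sub i (ltn_ord i))); rewrite inE xk.
rewrite !inE => /andP[xk xp]; rewrite xk andbT; apply/bigcupP.
by exists (Ordinal pk); rewrite ?nth_take.
Qed.

(** With two facets the whole vertex set is not a face. *)
Lemma dual_set0 : set0 \in alexander_dual S.
Proof.
rewrite inE setC0; apply: contraL S_facets => TS; rewrite -leqNgt.
apply/card_le1_eqP => A B; rewrite !inE => /maxsetP[_ A1] /maxsetP[_ B1].
by rewrite -(A1 _ TS (subsetT _)) -(B1 _ TS (subsetT _)).
Qed.

Lemma dual_betti : exists2 D : squarefree_complex K X, squarefree_resolution (alexander_dual S) D &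
  forall i j, sbetti D i j = match i with
    | 0 => (j == 0%N : nat)
    | 1 => count_mem j [seq (#|X| - n)%N | n <- facet_sizes s]
    | 2 => count_mem j [seq (#|X| - r)%N | r <- separator_sizes s]
    | _ => 0%N end.
Proof.
have [par parP] := leaf_parent; have [s_facets _] := s_leaf.
exists (@dual_complex K X s par); first exact: dual_resolution S_down s_facets parP size_leaf.
have cnt (g : seq {set X}) n : size g = n -> forall (f : 'I_n -> {set X}) j,
    (forall a : 'I_n, nth set0 g a = f a) ->
    #|[set a : 'I_n | #|~: f a| == j]| = count_mem j [seq (#|X| - #|A|)%N | A : {set X} <- g].
  move=> <- f j gf; rewrite count_map -sum1_count (big_nth set0) big_mkord -sum1_card.
  by apply: eq_bigl => a; rewrite inE /= gf [in RHS]cardsCs subKn ?max_card.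
move=> [|[|[|i]]] j.
- exact: sbetti0 (dual_resolution K S_down s_facets parP size_leaf).
- by rewrite /facet_sizes -map_comp; apply: (cnt s _ erefl (fun a : 'I_(size s) => nth set0 s a)).
- rewrite /separator_sizes -map_comp.
  apply: (cnt (separators s) (size s).-1 _ (fun k => separator s par k.+1)).
    by rewrite size_map size_iota.
  by move=> k; apply: nth_separators.
by apply/eqP; rewrite cards_eq0; apply/eqP/setP; case.
Qed.

Lemma leaf_sizes_le : all (fun n => (n <= #|X|)%N) (facet_sizes s) /\
  all (fun n => (n <= #|X|)%N) (separator_sizes s).
Proof. by split; apply/allP => n /mapP[A _ ->]; apply: max_card. Qed.

End LeafComplex.

(** The Betti numbers live on the strands [j = i] (only for [i = 0]) and [j = i + 1],
    so that the face numbers determine them. *)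
Lemma linear_betti_eq (K : fieldType) (X Y : finType) (S : {set {set X}}) (T : {set {set Y}})
    (s : seq {set X}) (t : seq {set Y}) (D : squarefree_complex K X) (E : squarefree_complex K Y) :
  down_closed S -> down_closed T -> leaf_order S s -> leaf_order T t ->
  set0 \in S -> set0 \in T -> (forall x, [set x] \in S) -> (forall y, [set y] \in T) ->
  squarefree_resolution S D -> squarefree_resolution T E -> #|X| = #|Y| ->
  face_number S =1 face_number T -> sbetti D =2 sbetti E.
Proof.
move=> Sd Td s_leaf t_leaf S0 T0 S1 T1 DS ET XY fST.
apply: (sbetti_off_strand DS ET XY (d := 1) fST) => i j; rewrite addn1 => ji.
have off (Z : finType) (P : {set {set Z}}) (p : seq {set Z}) (F : squarefree_complex K Z) :
    down_closed P -> leaf_order P p -> set0 \in P -> (forall z, [set z] \in P) ->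
    squarefree_resolution P F -> (0 < i)%N -> sbetti F i j = 0%N.
  move=> Pd p_leaf P0 P1 FP i0; have [par parP] := leaf_parent p_leaf.
  have [ij|ij] := ltnP i.+1 j.
    by have [p_facets _] := p_leaf; apply: (linear_strand_high Pd p_facets parP FP).
  apply/eqP; rewrite cards_eq0; apply/eqP/setP => b; rewrite !inE; apply/eqP => bj.
  case: i i0 ji ij b bj => // i _ ji ij b bj.
  have := linear_strand_low b FP P0 P1; rewrite bj leqNgt ltnS => /negP; apply.
  by move: ij; rewrite leq_eqVlt (negbTE ji).
have [i0|i0] := posnP i; first by rewrite i0 (sbetti0 _ DS) (sbetti0 _ ET).
by rewrite (off _ _ _ _ Sd s_leaf) // (off _ _ _ _ Td t_leaf).
Qed.

Theorem theorem7 (K : fieldType) (V W : finType) (e : rel V) (g : rel W)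
    (e_sym : symmetric e) (e_irr : irreflexive e) (e_chordal : chordal e)
    (g_sym : symmetric g) (g_irr : irreflexive g) (g_chordal : chordal g)
    (Delta : {set {set V}}) (Gamma : {set {set W}})
    (DeltaE : Delta = clique_complex e) (GammaE : Gamma = clique_complex g)
    (Delta_facets : (2 <= #|facets Delta|)%N)
    (Gamma_facets : (2 <= #|facets Gamma|)%N)
    (s : seq {set V}) (t : seq {set W})
    (s_leaf : leaf_order Delta s) (t_leaf : leaf_order Gamma t)
    (delta : int) (deltaE : delta = #|W|%:Z - #|V|%:Z) :
  (same_betti K (alexander_dual Delta) (alexander_dual Gamma) <->
     perm_eq [seq n%:Z | n <- facet_sizes t]
             [seq n%:Z + delta | n <- facet_sizes s] /\
     perm_eq [seq r%:Z | r <- separator_sizes t]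
             [seq r%:Z + delta | r <- separator_sizes s]) /\
  (#|V| = #|W| ->
   same_betti K (alexander_dual Delta) (alexander_dual Gamma) ->
   [/\ perm_eq (facet_sizes t) (facet_sizes s),
       perm_eq (separator_sizes t) (separator_sizes s),
       forall k : int, -1 <= k ->
         same_betti K (skeleton k Delta) (skeleton k Gamma)
     & forall k : int, -1 <= k ->
         same_betti K (skeleton k (alexander_dual Delta))
                      (skeleton k (alexander_dual Gamma))]).
Proof.
have Dd : down_closed Delta by rewrite DeltaE; apply: clique_down.
have Gd : down_closed Gamma by rewrite GammaE; apply: clique_down.
have [D DS Dbetti] := dual_betti K Dd Delta_facets s_leaf.
have [E ET Ebetti] := dual_betti K Gd Gamma_facets t_leaf.
have sameP := same_bettiP (dual_down Dd) (dual_down Gd) DS ET.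
have [sN sR] := leaf_sizes_le s; have [tN tR] := leaf_sizes_le t.
have mainP : same_betti K (alexander_dual Delta) (alexander_dual Gamma) <->
     perm_eq [seq n%:Z | n <- facet_sizes t]
             [seq n%:Z + delta | n <- facet_sizes s] /\
     perm_eq [seq r%:Z | r <- separator_sizes t]
             [seq r%:Z + delta | r <- separator_sizes s].
  rewrite sameP (perm_eq_shift sN tN deltaE) (perm_eq_shift sR tR deltaE).
  split=> [DE|[/permP ts1 /permP ts2] [|[|[|i]]] j]; last 4 first.
  - by rewrite Dbetti Ebetti.
  - by rewrite Dbetti Ebetti ts1.
  - by rewrite Dbetti Ebetti ts2.
  - by rewrite Dbetti Ebetti.
  split; apply/allP => j _ /=; apply/eqP.
    by have := DE 1%N j; rewrite Dbetti Ebetti.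
  by have := DE 2 j; rewrite Dbetti Ebetti.
split=> // VW same; have [ts1 ts2] := iffLR mainP same; have DE := iffLR sameP same.
have delta0 : delta = 0 by rewrite deltaE VW subrr.
have addd0 : (fun n : nat => n%:Z + delta) =1 Posz by move=> n; rewrite delta0 addr0.
rewrite !(eq_map addd0) in ts1 ts2.
have inj : injective Posz by move=> m n [].
have S0 : set0 \in Delta by rewrite DeltaE; apply: clique0.
have T0 : set0 \in Gamma by rewrite GammaE; apply: clique0.
have skel_same (S : {set {set V}}) (T : {set {set W}}) (A : squarefree_complex K V)
    (B : squarefree_complex K W) k : down_closed S -> down_closed T -> set0 \in S -> set0 \in T ->
    squarefree_resolution S A -> squarefree_resolution T B -> sbetti A =2 sbetti B ->
    -1 <= k -> same_betti K (skeleton k S) (skeleton k T).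
  move=> Sd Td S_0 T_0 AS BT AB k1; rewrite !skeletonE //; set d := absz _.
  have resS := minimal_squarefreeP K (skel_down (d := d) Sd) (skel0 d S_0).
  have resT := minimal_squarefreeP K (skel_down (d := d) Td) (skel0 d T_0).
  apply/(same_bettiP (skel_down (d := d) Sd) (skel_down (d := d) Td) resS resT).
  exact: (sbetti_skel AS BT resS resT VW AB).
split; [exact: (perm_map_inj inj)|exact: (perm_map_inj inj)| |] => k k1; last first.
  apply: (skel_same _ _ D E) => //; try exact: dual_down.
    exact: dual_set0 Delta_facets.
  exact: dual_set0 Gamma_facets.
have resS := minimal_squarefreeP K Dd S0; have resT := minimal_squarefreeP K Gd T0.
apply: (skel_same _ _ _ _ _ Dd Gd S0 T0 resS resT) => //.
apply: (linear_betti_eq Dd Gd s_leaf t_leaf S0 T0 _ _ resS resT VW).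
- by move=> x; rewrite DeltaE; apply: clique1.
- by move=> x; rewrite GammaE; apply: clique1.
exact: (eq_face_number_dual VW (face_number_sbetti DS ET VW DE)).
Qed.
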